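(* (a) Let $\mathbf p=(p_n)\subset[1,\infty)$ be an unbounded sequence. Then the subspace $\mathbf c_{00}$ of all real sequences which vanish at all but finitely many terms is dense in $(\ell^{(p_n)},\tau_{\rho_{\mathbf p}})$. Hence $(\ell^{(p_n)},\tau_{\rho_{\mathbf p}})$ is separable. (b) Let $\Omega\subset\mathbb{R}^n$ be a domain and let $p\in C(\Omega)$ satisfy $1\le p(x)<\infty$ for every $x\in\Omega$, possibly with $p^+=\sup_\Omega p=\infty$. Then $C_0^\infty(\Omega)$ is $\tau_{\rho_p}$-dense in $L^{p(\cdot)}(\Omega)$, and $(L^{p(\cdot)}(\Omega),\tau_{\rho_p})$ is separable, even when $p$ is unbounded.
   Context: Sequence space: for $\mathbf p=(p_n)\subset[1,\infty)$ and a real sequence $(a_j)$, $\rho_{\mathbf p}((a_j))=\sum_{j=1}^\infty|a_j|^{p_j}\in[0,\infty]$, and $\ell^{(p_n)}=\{(a_j)\in\mathbb{R}^{\mathbb N}:\rho_{\mathbf p}(\lambda(a_j))<\infty\text{ for some }\lambda>0\}$. Lebesgue space: for measurable $u$ on $\Omega$ (functions equal a.e. being identified), $\rho_p(u)=\int_\Omega|u(x)|^{p(x)}\,dx$, and $L^{p(\cdot)}(\Omega)=\{u:\rho_p(\lambda u)<\infty\text{ for some }\lambda>0\}$. $C_0^\infty(\Omega)$ denotes the smooth functions with compact support in $\Omega$. A domain is a nonempty connected open set. Modular topology: for either space, denoted $E$ with modular $\rho$, $B_{\rho,\varepsilon}(x)=\{y\in E:\rho(y-x)<\varepsilon\}$,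 and $A\subseteq E$ is $\tau_\rho$-open iff for every $x\in A$ there exists $\varepsilon>0$ with $B_{\rho,\varepsilon}(x)\subset A$. (The balls are not asserted to be open.) *)

(* Defs.v *)
From HB Require Import structures.
From mathcomp Require Import all_boot all_order all_algebra.
From mathcomp Require Import all_classical all_reals all_analysis.

Set Implicit Arguments.
Unset Strict Implicit.
Unset Printing Implicit Defensive.
Import Order.TTheory GRing.Theory Num.Theory.
Import numFieldNormedType.Exports.

Local Open Scope classical_set_scope.
Local Open Scope ring_scope.
Local Open Scope ereal_scope.

(* The carrier of the modular topology is a subset E of an ambient group X, so
   that differences and rho make sense even before E is known to be a
   subspace.  modular_space rho E is the type of elements of E. *)
Definition modular_space (R : realType) (X : zmodType) (rho : X -> \bar R)
  (E : set X) : Type := set_type E.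

Section modular_topology.
Context {R : realType} {X : zmodType}.
Variables (rho : X -> \bar R) (E : set X).
Local Notation modular_space := (modular_space rho E).

HB.instance Definition _ := Choice.on modular_space.

Definition modular_ball (e : R) (x : modular_space) : set modular_space :=
  [set y | rho (val y - val x)%R < e%:E].

Definition modular_open : set_system modular_space :=
  [set A | forall x, A x -> exists2 e : R, (0 < e)%R & modular_ball e x `<=` A].

Let modular_openT : modular_open setT.
Proof. by move=> x _; exists 1%R. Qed.

Let modular_openI : setI_closed modular_open.
Proof.
move=> A B oA oB x [/oA[a a0 aA] /oB[b b0 bB]].
exists (Num.min a b); first by rewrite lt_min a0.
move=> y; rewrite /modular_ball /= => ry; split; [apply: aA|apply: bB];
  by rewrite /modular_ball /= (lt_le_trans ry)// lee_fin ge_min lexx ?orbT.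
Qed.

Let modular_open_bigU (I : Type) (f : I -> set modular_space) :
  (forall i, modular_open (f i)) -> modular_open (\bigcup_i f i).
Proof.
move=> of_ x [i _ /(of_ i)[e e0 ef]].
by exists e => // y /ef fy; exists i.
Qed.

HB.instance Definition _ := isOpenTopological.Build modular_space
  modular_openT modular_openI modular_open_bigU.

End modular_topology.

Definition separable_space (T : topologicalType) : Prop :=
  exists S : set T, countable S /\ dense S.

Section variable_exponent_sequences.
Context {R : realType}.
Variable p : nat -> R.

Definition seq_modular (a : nat -> R) : \bar R :=
  \sum_(0 <= j <oo) (`|a j| `^ p j)%:E.

Definition ell_set : set (nat -> R) :=
  [set a | exists2 l : R, (0 < l)%R & seq_modular (fun j => l * a j)%R < +oo].

Definition ell_space := modular_space seq_modular ell_set.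
HB.instance Definition _ := Topological.on ell_space.

End variable_exponent_sequences.

Definition c00 {R : realType} : set (nat -> R) :=
  [set a | finite_set [set j | a j != 0%R]].

(* Lebesgue measure on R^(n+1): outer measure from countable covers by
   half-open boxes, restricted to its Caratheodory sigma-algebra (that is, the
   Lebesgue measurable sets, not only the Borel ones). *)
Section lebesgue_rV.
Context {R : realType} {n : nat}.
Notation Rn := 'rV[R]_n.+1.

Definition box (ab : Rn * Rn) : set Rn :=
  [set x | forall i, (ab.1 0 i < x 0 i <= ab.2 0 i)%R].

Definition box_vol (ab : Rn * Rn) : \bar R :=
  (\prod_(i < n.+1) Num.max 0 (ab.2 0 i - ab.1 0 i))%:E.

Definition box_cover (A : set Rn) : set (nat -> Rn * Rn) :=
  [set F | A `<=` \bigcup_k box (F k)].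

Definition lebesgue_outer (A : set Rn) : \bar R :=
  ereal_inf [set \sum_(0 <= k <oo) box_vol (F k) | F in box_cover A].

Lemma box_vol_ge0 ab : 0 <= box_vol ab.
Proof. by rewrite lee_fin; apply: prodr_ge0 => i _; rewrite le_max lexx. Qed.

Let lebesgue_outer_ge0 A : 0 <= lebesgue_outer A.
Proof.
apply: le_ereal_inf_tmp => _ [F _ <-].
by apply: nneseries_ge0 => k _ _; exact: box_vol_ge0.
Qed.

Let lebesgue_outer0 : lebesgue_outer set0 = 0.
Proof.
apply/eqP; rewrite eq_le lebesgue_outer_ge0 andbT.
apply: ereal_inf_lbound; exists (fun=> (0%R, 0%R)) => //=.
rewrite eseries0// => k _ _; rewrite /box_vol.
by rewrite (bigD1 ord0)//= subrr maxxx mul0r.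
Qed.

Let le_lebesgue_outer :
  {homo lebesgue_outer : A B / A `<=` B >-> A <= B}.
Proof.
move=> A B AB; apply: ereal_inf_le_tmp => _ [F BF <-].
by exists F => //; exact: subset_trans BF.
Qed.

Let lebesgue_outer_sigma_subadditive : sigma_subadditive lebesgue_outer.
Proof.
move=> A; have [[i ioo]|] := pselect (exists i, lebesgue_outer (A i) = +oo).
  rewrite (eseries_pinfty _ _ ioo) ?leey// => k _.
  by rewrite -ltNye (lt_le_trans _ (lebesgue_outer_ge0 _)).
rewrite -forallNE => Aoo.
apply/lee_addgt0Pr => e e0.
rewrite (le_trans _ (epsilon_trick _ _ (ltW e0)))//.
have [G AG] : {G : nat -> nat -> Rn * Rn & forall k, box_cover (A k) (G k) /\
    \sum_(0 <= j <oo) box_vol (G k j) <=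
    lebesgue_outer (A k) + (e / (2 ^ k.+1)%:R)%:E}.
  apply: (@choice _ _ (fun k B => box_cover (A k) B /\
    \sum_(0 <= j <oo) box_vol (B j) <=
    lebesgue_outer (A k) + (e / (2 ^ k.+1)%:R)%:E)) => k.
  have ek0 : (0 < e / (2 ^ k.+1)%:R)%R.
    by rewrite divr_gt0// ltr0n expn_gt0.
  have fin : lebesgue_outer (A k) \is a fin_num.
    by rewrite ge0_fin_numE// ltey; apply/eqP; exact: Aoo.
  have [_ [B AB <-] Be] := lb_ereal_inf_adherent ek0 fin.
  by exists B; split=> //; exact: ltW.
have volG_ge0 x : 0 <= (box_vol \o uncurry G) x by exact: box_vol_ge0.
apply: (@le_trans _ _ (\esum_(i in setT) (box_vol \o uncurry G) i)).
  apply: ereal_inf_lbound => /=.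
  have /card_esym/ppcard_eqP[f] := card_nat2.
  exists (uncurry G \o f).
    move=> t [i _ /(AG i).1[j _ Gt]]; exists (f^-1%FUN (i, j)) => //=.
    by rewrite invK ?inE.
  rewrite -(esum_pred_image (box_vol \o uncurry G) _ xpredT) ?[fun=> _]set_true//.
  by rewrite image_eq.
rewrite (_ : esum _ _ =
    \sum_(0 <= i <oo) \sum_(0 <= j <oo) box_vol (G i j)); last first.
  pose J : nat -> set (nat * nat) := fun i => [set (i, j) | j in setT].
  rewrite (_ : setT = \bigcup_k J k); last first.
    by rewrite predeqE => -[a b]; split => // _; exists a => //; exists b.
  rewrite esum_bigcupT /=; last 2 first.
    - apply/trivIsetP => i j _ _ ij.
      rewrite predeqE => -[k m] /=; split => //= -[] [_] _ [<-{k} _].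
      by move=> [m' _] [] /esym/eqP; rewrite (negbTE ij).
    - by move=> /= [k m]; exact: box_vol_ge0.
  rewrite -(image_id [set: nat]) -fun_true esum_pred_image//; last first.
    by move=> k _; apply: esum_ge0 => j _; exact: volG_ge0.
  apply: eq_eseriesr => /= j _.
  rewrite -(esum_pred_image (box_vol \o uncurry G) (pair j) predT)//=; last 2 first.
    - by move=> ? _; exact: box_vol_ge0.
    - by move=> ? ? _ _; exact: (@can_inj _ _ _ snd).
  by congr esum; rewrite predeqE => -[a b]; split; move=> [i _ <-]; exists i.
apply: lee_nneseries => k _; last exact: (AG k).2.
by move=> _; apply: nneseries_ge0 => j _ _; exact: box_vol_ge0.
Qed.

HB.instance Definition _ := isOuterMeasure.Build R Rn lebesgue_outer
  lebesgue_outer0 lebesgue_outer_ge0 le_lebesgue_outer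
  lebesgue_outer_sigma_subadditive.

Definition lebesgue_type := caratheodory_type lebesgue_outer.
HB.instance Definition _ := Measurable.on lebesgue_type.

Definition lebesgue_rV : set lebesgue_type -> \bar R := lebesgue_outer.
HB.instance Definition _ := isMeasure.Build _ _ _ lebesgue_rV
  (caratheodory_measure0 _) (@caratheodory_measure_ge0 _ _ _)
  (@caratheodory_measure_sigma_additive _ _ _).

End lebesgue_rV.

(* Functions on Omega are represented by total functions on R^(n+1), of which
   only the values on Omega matter.  ae_class Omega is the quotient of all
   functions, measurable or not, by a.e. equality on Omega; Lp_set keeps the
   classes of measurable functions.  As lebesgue_rV is complete, every
   representative of such a class is measurable on Omega, so using repr in
   Lp_modular is harmless. *)
Section variable_exponent_Lebesgue.
Context {R : realType} {n : nat}.
Local Notation Rn := 'rV[R]_n.+1.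
Local Notation mu := (@lebesgue_rV R n).
Implicit Types (u : Rn -> R) (Omega : set Rn).

Definition ae_null Omega : {pred Rn -> R} :=
  fun u => `[< u = \0 %[ae mu in Omega] >].

Let ae_null_zmod_closed Omega : zmod_closed (ae_null Omega).
Proof.
have aeF : Filter (almost_everywhere mu).
  exact: ae_filter_ringOfSetsType.
split=> [|u v /asboolP u0 /asboolP v0]; apply/asboolP.
  by apply: nearW => x _.
apply: filterS2 u0 v0 => x u0 v0 Ox.
by rewrite -[LHS]/(u x - v x)%R u0// v0// subr0.
Qed.

HB.instance Definition _ Omega :=
  GRing.isZmodClosed.Build (Rn -> R) (ae_null Omega) (ae_null_zmod_closed Omega).

Definition ae_class Omega := Quotient.quot (ae_null Omega).
HB.instance Definition _ Omega := GRing.Zmodule.on (ae_class Omega).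
HB.instance Definition _ Omega := EqQuotient.on (ae_class Omega).

Definition to_class Omega (u : Rn -> R) : ae_class Omega :=
  \pi_(ae_class Omega)%qT u.

Lemma to_classP Omega u v :
  to_class Omega u = to_class Omega v <-> u = v %[ae mu in Omega].
Proof.
have aeF : Filter (almost_everywhere mu).
  exact: ae_filter_ringOfSetsType.
transitivity ((u - v)%R \in ae_null Omega).
  by split=> [/eqP|uv]; [|apply/eqP]; rewrite eqmodE.
by split=> [/asboolP|uv]; [|apply/asboolP; move: uv];
  apply: filterS => x uv Ox; move: (uv Ox) => /eqP;
  rewrite -?[(u - v)%R x]/(u x - v x)%R /= ?subr_eq0 => /eqP// ->;
  rewrite -[LHS]/(v x - v x)%R subrr.
Qed.

Variables (p : Rn -> R) (Omega : set Rn).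

Definition fun_modular u : \bar R :=
  \int[mu]_(x in Omega) (`|u x| `^ p x)%:E.

Definition Lp_modular (c : ae_class Omega) : \bar R := fun_modular (repr c).

Definition Lp_set : set (ae_class Omega) :=
  [set c | exists u, [/\ to_class Omega u = c,
    measurable_fun (Omega : set (@lebesgue_type R n)) u &
    exists2 l : R, (0 < l)%R & fun_modular (fun x => l * u x)%R < +oo]].

Definition Lp_space := modular_space Lp_modular Lp_set.
HB.instance Definition _ := Topological.on Lp_space.

End variable_exponent_Lebesgue.
Arguments Lp_modular {R n} p Omega c.
Arguments Lp_set {R n} p Omega.

(* Test functions on Omega are identified with their extension by zero to the
   whole of R^(n+1). *)
Section test_functions.
Context {R : realType} {n : nat}.
Local Notation Rn := 'rV[R]_n.+1.

Definition partial (i : 'I_n.+1) (f : Rn -> R) : Rn -> R :=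
  fun x => 'D_(delta_mx ord0 i) f x.

Definition smooth (f : Rn -> R) : Prop :=
  forall s : seq 'I_n.+1, let g := foldr partial f s in
    continuous g /\ forall i x, derivable g x (delta_mx ord0 i).

Definition C0infty (Omega : set Rn) : set (Rn -> R) :=
  [set f | smooth f /\
    let K := closure [set x | f x != 0%R] in compact K /\ K `<=` Omega].

End test_functions.

(* Main.v *)
(* Let S be the countable set of finite sums of some "atoms": rational multiples
   of unit vectors in (a), rational multiples of smooth bumps with rational
   parameters in (b).  The topological closure of S contains every limit, in the
   sense of the modular, of its own elements.  It is also closed under addition,
   since balls are translates of each other.

   The modular of an element u may be infinite, but that of u / m is finite for
   some integer m > 0; as u is the sum of m copies of u / m, additivity reduces
   the theorem to u of finite modular, for which dominated convergence is
   available.  In (a) such a u is the modular limit of its truncations.  In (b)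
   its positive and negative parts are limits of simple
   functions carried by finitely many boxes, the closures of which lie in Omega,
   where p is bounded; measurable subsets of such a box are approximated by
   finite unions of boxes, and boxes by smooth bumps. *)
Require Import Defs.
From HB Require Import structures.
From mathcomp Require Import all_boot all_order all_algebra.
From mathcomp Require Import finmap ring lra.
From mathcomp Require Import all_classical all_reals all_analysis measurable_realfun.
Set Implicit Arguments.
Unset Strict Implicit.
Unset Printing Implicit Defensive.
Import Order.TTheory GRing.Theory Num.Theory.
Import numFieldNormedType.Exports.

Local Open Scope classical_set_scope.
Local Open Scope ring_scope.

(** * Closures in the modular topology *)

Section modular_closure.
Context {R : realType} {X : zmodType}.
Variables (rho : X -> \bar R) (E : set X).
Local Notation space := (modular_space rho E).

(** The closure is taken in the subtype and brought back to the ambient group, where sums and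
    differences need no membership proofs. *)
Definition modular_closure (S : set X) : set X :=
  [set x | exists2 a : space, val a = x & closure [set b : space | S (val b)] a].

(** A modular ball need not be a neighbourhood of its centre, so adherence is tested on open
    sets. *)
Lemma modular_closureP (S : set X) (x : X) (Ex : E x) :
  modular_closure S x <->
  forall A : set space, modular_open A ->
    forall a, A a -> val a = x -> exists2 b, A b & S (val b).
Proof.
split=> [[a' a'x ca'] A oA a Aa ax|h].
  have aa' : a = a' by apply: val_inj; rewrite ax.
  have /ca'[b [Sb Ab]] : nbhs a' A by rewrite -aa'; apply: open_nbhs_nbhs.
  by exists b.
exists (SigSub (mem_set Ex) : space) => //= B.
rewrite nbhsE => -[A [oA Ax] AB].
have [b Ab Sb] := h A oA _ Ax erefl.
by exists b; split=> //; exact: AB.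
Qed.

Lemma modular_closure_sub (S : set X) : modular_closure S `<=` E.
Proof. by move=> x [a <- _]; exact/set_mem/valP. Qed.

Lemma subset_modular_closure (S : set X) : S `<=` E -> S `<=` modular_closure S.
Proof.
by move=> SE x Sx; apply/modular_closureP => [|A _ a Aa ax]; [exact: SE|];
  exists a => //; rewrite ax.
Qed.

(** An open set around [x] contains a ball around [x], hence some [y] of the closure; being open
    around [y] too, it meets [S]. *)
Lemma modular_closure_lim (S : set X) (x : X) : E x ->
  (forall e : R, 0 < e ->
    exists2 y, modular_closure S y & (rho (y - x)%R < e%:E)%E) ->
  modular_closure S x.
Proof.
move=> Ex h; apply/modular_closureP => // A oA a Aa ax.
have [e e0 eA] := oA a Aa.
have [y cy yx] := h e e0.
have [b by_ cb] := cy.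
apply: ((modular_closureP S (modular_closure_sub cy)).1 cy A oA b) => //.
by apply: eA; rewrite /modular_ball /= by_ ax.
Qed.

Hypothesis EA : forall x y, E x -> E y -> E (x + y)%R.

(* Translations by elements of [E] are homeomorphisms, because balls are
   translates of each other. *)
Lemma modular_closure_add (S : set X) : S `<=` E ->
  (forall x y, S x -> S y -> S (x + y)) ->
  forall x y, modular_closure S x -> modular_closure S y ->
  modular_closure S (x + y).
Proof.
move=> SE SA.
have shift s x (T : set X) : E s -> (forall t, S t -> T (t + s)) ->
    modular_closure S x -> modular_closure T (x + s).
  move=> Es ST cx; have Ex := modular_closure_sub cx.
  apply/modular_closureP => [|A oA a Aa ax]; first exact: EA.
  have tE (b : space) : val b + s \in E by apply/mem_set/EA => //; exact/set_mem/valP.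
  pose t (b : space) : space := SigSub (tE b).
  (* Translation preserves differences, so the radius that serves at [t b] serves at [b]. *)
  have oB : modular_open (t @^-1` A).
    move=> b /= /oA[e e0 eA]; exists e => // c.
    rewrite /modular_ball /= => cb; apply: eA; rewrite /modular_ball /=.
    by rewrite opprD addrACA subrr addr0.
  have xE : x \in E by exact/mem_set.
  have [||b Ab Sb] := (modular_closureP S Ex).1 cx _ oB (SigSub xE : space) => //=.
    by rewrite (_ : t _ = a)//; apply: val_inj; rewrite ax.
  by exists (t b) => //=; exact: ST.
have shift1 s x : S s -> modular_closure S x -> modular_closure S (x + s).
  by move=> Ss; apply: shift; [exact: SE|move=> t St; exact: SA].
move=> x y cx cy; have Ex := modular_closure_sub cx; have Ey := modular_closure_sub cy.
(* One variable at a time: translating by elements of [S] puts [s + y] in the closure, then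
   translating by [y] puts [x + y] in the closure of the closure, which the last lines collapse. *)
have cxy : modular_closure (modular_closure S) (x + y).
  by apply: shift => // s Ss; rewrite addrC; exact: shift1 Ss cy.
have h := (modular_closureP _ (EA Ex Ey)).1 cxy.
apply/modular_closureP => [|A oA a Aa ax]; first exact: EA.
have [b Ab cb] := h A oA a Aa ax.
exact: ((modular_closureP S (modular_closure_sub cb)).1 cb A oA b).
Qed.

Lemma dense_modular_closure (S : set X) : E `<=` modular_closure S ->
  dense [set a : space | S (val a)].
Proof.
move=> ES A [a Aa] oA.
have Ea : E (val a) by exact/set_mem/valP.
have [b Ab Sb] := (modular_closureP S Ea).1 (ES _ Ea) A oA a Aa erefl.
by exists b.
Qed.

Lemma separable_modular_closure (S : set X) : countable S ->
  E `<=` modular_closure S -> separable_space space.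
Proof.
move=> cS ES; exists [set a : space | S (val a)].
split; last exact: dense_modular_closure.
have /countable_injP[f fi] := cS.
apply/countable_injP; exists (fun a => f (val a)) => a b aS bS fab.
by apply/val_inj/fi.
Qed.

End modular_closure.


(** * Countable sets of finite sums *)

Section finite_sums.
Context {X : zmodType} {T : countType}.
Variables (P : set T) (f : T -> X).

(** With lists as indices, addition is concatenation and countability is that of [seq T]. *)
Definition finite_sums : set X :=
  [set x | exists2 s : seq T, (forall t, t \in s -> P t) & x = \sum_(t <- s) f t].

Lemma countable_finite_sums : countable finite_sums.
Proof.
pose g (s : seq T) := \sum_(t <- s) f t.
pose D := [set s : seq T | forall t, t \in s -> P t].
suff -> : finite_sums = g @` D by exact: sub_countable (card_image_le g D) (countableP _).
by apply/seteqP; split=> [x [s Ps ->]|x [s Ps <-]]; exists s.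
Qed.

Lemma finite_sums0 : finite_sums 0.
Proof. by exists [::]; rewrite ?big_nil. Qed.

Lemma finite_sums_atom t : P t -> finite_sums (f t).
Proof.
by move=> Pt; exists [:: t]; rewrite ?big_seq1// => u; rewrite inE => /eqP->.
Qed.

Lemma finite_sumsD x y : finite_sums x -> finite_sums y -> finite_sums (x + y).
Proof.
move=> [s Ps ->] [t Pt ->]; exists (s ++ t); last by rewrite big_cat.
by move=> u; rewrite mem_cat => /orP[/Ps|/Pt].
Qed.

End finite_sums.

(** With half the smaller factor, the left argument is at most the larger of [|a * x|] and
    [|b * y|], whose power is one of the terms on the right. The constant does not depend on [p], so
    the bound can be summed or integrated over a variable exponent. *)
Lemma powR_normD_le (R : realType) (p a b x y : R) : 0 <= p -> 0 < a -> 0 < b ->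
  `|Num.min a b / 2 * (x + y)| `^ p <= `|a * x| `^ p + `|b * y| `^ p.
Proof.
move=> p0 a0 b0; set m := Num.min a b.
have m0 : 0 <= m by rewrite le_min !ltW.
have : `|m / 2 * (x + y)| <= Num.max `|a * x| `|b * y|.
  rewrite mulrAC normrM (@ger0_norm _ 2^-1)// ler_pdivrMr// mulrDr mulr_natr mulr2n.
  rewrite (le_trans (ler_normD _ _))// lerD// le_max !normrM; apply/orP.
    by left; rewrite ler_wpM2r// !ger0_norm ?(ltW a0)// ge_min lexx.
  by right; rewrite ler_wpM2r// !ger0_norm ?(ltW b0)// ge_min lexx orbT.
move=> h; rewrite (le_trans (ge0_ler_powR p0 _ _ h))//.
  by rewrite nnegrE le_max normr_ge0.
by rewrite maxElt; case: ifPn => _; rewrite ?lerDr ?lerDl powR_ge0.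
Qed.

Lemma cvge0_near_lt (R : realType) (u : nat -> \bar R) (e : R) : 0 < e ->
  (u @ \oo --> 0)%E -> \forall n \near \oo, (u n < e%:E)%E.
Proof.
move=> e0 u0; apply: (u0 [set x | x < e%:E]%E).
by apply: open_nbhs_nbhs; split; [exact: open_ereal_lt_ereal|rewrite /= lte_fin].
Qed.

(** * Sequence spaces with variable exponent *)

Section sequences.
Context {R : realType}.
Variable p : nat -> R.
Hypothesis p1 : forall j, 1 <= p j.
Local Notation rho := (seq_modular p).
Implicit Types a b : nat -> R.

Let p0 j : 0 <= p j. Proof. exact: le_trans (p1 j). Qed.
Let pN0 j : p j != 0. Proof. by rewrite gt_eqF// (lt_le_trans _ (p1 j)). Qed.

Lemma ell_setD a b : ell_set p a -> ell_set p b -> ell_set p (a + b).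
Proof.
move=> [l l0 la] [m m0 mb]; exists (Num.min l m / 2).
  by rewrite divr_gt0// lt_min l0.
apply: le_lt_trans (lte_add_pinfty la mb).
rewrite -nneseriesD => [|i _ _|i _ _]; rewrite ?lee_fin ?powR_ge0//.
apply: lee_nneseries => [i _ _|i _]; first by rewrite lee_fin powR_ge0.
by rewrite -EFinD lee_fin; exact: powR_normD_le.
Qed.

Lemma seq_modular_finite_support a N : (forall j, (N <= j)%N -> a j = 0) ->
  rho a = (\sum_(0 <= j < N) (`|a j| `^ p j)%:E)%E.
Proof.
move=> aN; rewrite /seq_modular (nneseries_split 0%N N) => [|k _]; last first.
  by rewrite lee_fin powR_ge0.
rewrite add0n [X in (_ + X)%E]eseries0 ?adde0// => i Ni _.
by rewrite aN// normr0 powR0.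
Qed.

Lemma c00_support a : c00 a -> exists N, forall j, (N <= j)%N -> a j = 0.
Proof.
move=> /finite_seqP[X aX].
exists (\max_(j <- X) j).+1 => j; apply: contraTeq => aj.
rewrite -ltnNge ltnS; have jX : j \in X by have : [set j | a j != 0] j by []; rewrite aX.
exact: leq_bigmax_seq.
Qed.

Lemma sub_c00_ell_set : c00 `<=` ell_set p.
Proof.
move=> a /c00_support[N aN]; exists 1 => //.
rewrite (@seq_modular_finite_support _ N) => [|j /aN ->]; last by rewrite mulr0.
by rewrite sumEFin ltey.
Qed.

Definition seq_atom (t : rat * nat) : nat -> R :=
  fun j => if j == t.2 then ratr t.1 else 0.

Local Notation S := (finite_sums setT seq_atom).
Local Notation cl := (modular_closure rho (ell_set p) S).

Lemma seq_atoms_c00 : S `<=` c00.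
Proof.
move=> _ [s _ ->]; elim: s => [|t s ih].
  by rewrite big_nil; apply: (@sub_finite_set _ _ set0) => // j; rewrite /= eqxx.
rewrite big_cons; apply: (@sub_finite_set _ _ (t.2 |` [set j | (\sum_(t <- s) seq_atom t) j != 0])).
  move=> j; rewrite /= -[X in X != 0]/(seq_atom t j + (\sum_(t <- s) seq_atom t) j).
  rewrite {1}/seq_atom; case: (j =P t.2) => [->|_]; first by left.
  by rewrite add0r; right.
by rewrite finite_setU; split.
Qed.

Let S_ell : S `<=` ell_set p.
Proof. exact: subset_trans seq_atoms_c00 sub_c00_ell_set. Qed.

Let clD a b : cl a -> cl b -> cl (a + b).
Proof.
apply: modular_closure_add; [exact: ell_setD|exact: S_ell|exact: finite_sumsD].
Qed.

Let cl0 : cl 0.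
Proof. exact: (subset_modular_closure rho S_ell (finite_sums0 _ _)). Qed.

Lemma cl_delta (c : R) i : cl (fun j => if j == i then c else 0).
Proof.
have cE : ell_set p (fun j => if j == i then c else 0).
  apply: sub_c00_ell_set; apply: sub_finite_set (finite_set1 i) => j /=.
  by case: (j =P i) => // _; rewrite eqxx.
apply: modular_closure_lim => // e e0.
(* The gap between [q] and [c] is kept below 1 as well as below [e]: an exponent at least 1 then
   does not increase it. *)
have [q] : exists q : rat, ratr q \in `]c, c + Num.min 1 e[.
  by apply: rat_in_itvoo; rewrite ltrDl lt_min ltr01.
rewrite in_itv /= => /andP[cq]; rewrite -ltrBlDl lt_min => /andP[q1 qe].
exists (seq_atom (q, i)).
  by apply: subset_modular_closure => //; exact: finite_sums_atom.
rewrite (@seq_modular_finite_support _ i.+1) => [|j ij].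
  rewrite big_nat_recr//= big1_seq ?add0e.
    rewrite lte_fin -[X in `|X|]/(seq_atom (q, i) i - (if i == i then c else 0)).
    rewrite /seq_atom/= eqxx; have qc0 : 0 < ratr q - c by rewrite subr_gt0.
    by rewrite gtr0_norm// (le_lt_trans _ qe)// ge1r_powR// qc0 ltW.
  move=> j /=; rewrite mem_index_iota /= => ji.
  rewrite -[X in `|X|]/(seq_atom (q, i) j - (if j == i then c else 0)).
  by rewrite /seq_atom/= ltn_eqF// subrr normr0 powR0.
rewrite -[LHS]/(seq_atom (q, i) j - (if j == i then c else 0)).
by rewrite /seq_atom/= gtn_eqF// subrr.
Qed.

Lemma cl_truncation a N : cl (fun j => if (j < N)%N then a j else 0).
Proof.
elim: N => [|N ih]; first exact: cl0.
rewrite (_ : (fun _ => _) = (fun j => if (j < N)%N then a j else 0) +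
    (fun j => if j == N then a N else 0)).
  by apply: clD => //; exact: cl_delta.
apply/funext => j; rewrite -[RHS]/(_ + (if j == N then a N else 0))/= ltnS leq_eqVlt.
by case: eqP => [->|_]; rewrite ?ltnn ?add0r ?addr0.
Qed.

(** The modular of the truncation error is at most a tail of the convergent series. *)
Lemma cl_finite_modular a : (rho a < +oo)%E -> cl a.
Proof.
move=> rhoa; apply: modular_closure_lim => [|e e0].
  by exists 1 => //; under [fun _ => _]eq_fun do rewrite mul1r.
have f0 k : true -> (0 <= (`|a k| `^ p k)%:E)%E by rewrite lee_fin powR_ge0.
have [N _ /(_ N (leqnn N)) Ne] := cvge0_near_lt e0 (nneseries_tail_cvg rhoa f0).
exists (fun j => if (j < N)%N then a j else 0); first exact: cl_truncation.
apply: le_lt_trans Ne; rewrite /seq_modular (nneseries_split 0%N N) => [|k _]; last first.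
  by rewrite lee_fin powR_ge0.
rewrite add0n big1_seq ?add0e => [|j /andP[_]].
  apply: lee_nneseries => [i _ _|i _]; first by rewrite lee_fin powR_ge0.
  rewrite lee_fin ge0_ler_powR// ?nnegrE//.
  rewrite -[X in `|X| <= _]/((if (i < N)%N then a i else 0) - a i).
  by case: ifP => _; rewrite ?subrr ?normr0// sub0r normrN.
rewrite mem_index_iota /= => jN.
rewrite -[X in `|X|]/((if (j < N)%N then a j else 0) - a j).
by rewrite jN subrr normr0 powR0.
Qed.

Lemma sub_ell_set_cl : ell_set p `<=` cl.
Proof.
move=> a [l l0 la].
(* Since [m] exceeds 1/l, the sequence a/m is dominated by l a and has finite modular; adding [m]
   copies of it returns [a]. *)
pose m := (Num.truncn l^-1).+1.
pose b : nat -> R := fun j => m%:R^-1 * a j.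
have -> : a = b *+ m.
  apply/funext => j; rewrite -[RHS]/((b *+ m) j) natmulfctE /b /= -[RHS]mulr_natr.
  by rewrite mulrAC mulVf ?mul1r// pnatr_eq0.
have clb : cl b.
  apply: cl_finite_modular; apply: le_lt_trans la.
  apply: lee_nneseries => [i _ _|i _]; first by rewrite lee_fin powR_ge0.
  rewrite lee_fin ge0_ler_powR// ?nnegrE//= !normrM ler_wpM2r//.
  rewrite !ger0_norm ?(ltW l0)// invf_ple ?posrE// ltW//.
  by rewrite truncnS_gt.
elim: (X in b *+ X) => [|k ih]; first by rewrite mulr0n; exact: cl0.
by rewrite mulrSr; exact: clD.
Qed.

Lemma separable_ell_space :
  dense [set a : ell_space p | c00 (val a)] /\ separable_space (ell_space p).
Proof.
split; last first.
  exact: separable_modular_closure (countable_finite_sums _ _) sub_ell_set_cl.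
(* The finite sums of rational atoms are dense and lie in [c00], so [c00] is dense as well. *)
have dS := dense_modular_closure sub_ell_set_cl.
by move=> A A0 oA; have [a [Aa /seq_atoms_c00 ca]] := dS A A0 oA; exists a.
Qed.

End sequences.

(** * Lebesgue measurability of boxes and open sets *)

Section lebesgue_rV_sets.
Context {R : realType} {n : nat}.
Notation Rn := 'rV[R]_n.+1.
Notation leb := (@lebesgue_outer R n).
Notation T := (@lebesgue_type R n).

(** The parts of a half-open box on the two sides of the hyperplane x_i = c. If the hyperplane
    misses the box, the degenerate part has volume 0 because [box_vol] truncates side lengths at
    0. *)
Let cut_lo (i : 'I_n.+1) (c : R) (ab : Rn * Rn) : Rn * Rn :=
  (\row_j (if j == i then Num.max (ab.1 0 j) c else ab.1 0 j), ab.2).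
Let cut_hi (i : 'I_n.+1) (c : R) (ab : Rn * Rn) : Rn * Rn :=
  (ab.1, \row_j (if j == i then Num.min (ab.2 0 j) c else ab.2 0 j)).

Let box_cut_lo i c ab x : box ab x -> c < x 0 i -> box (cut_lo i c ab) x.
Proof.
move=> abx cx j; rewrite /= mxE; have /andP[ax ->] := abx j.
by rewrite andbT; case: (j =P i) => [ji|//]; rewrite gt_max ax ji cx.
Qed.

Let box_cut_hi i c ab x : box ab x -> x 0 i <= c -> box (cut_hi i c ab) x.
Proof.
move=> abx cx j; rewrite /= mxE; have /andP[-> xb] := abx j.
by case: (j =P i) => [ji|//]; rewrite le_min xb ji.
Qed.

Let box_vol_cut i c ab :
  (box_vol (cut_lo i c ab) + box_vol (cut_hi i c ab) = box_vol ab)%E.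
Proof.
rewrite /box_vol -EFinD; congr (_%:E).
rewrite (bigD1 i)//= [in X in _ + X](bigD1 i)//= [RHS](bigD1 i)//= !mxE eqxx.
rewrite (eq_bigr (fun j => Num.max 0 (ab.2 0 j - ab.1 0 j))); last first.
  by move=> j ji; rewrite mxE (negbTE ji).
rewrite [in X in _ + X](eq_bigr (fun j => Num.max 0 (ab.2 0 j - ab.1 0 j))); last first.
  by move=> j ji; rewrite mxE (negbTE ji).
rewrite -mulrDl; congr (_ * _).
rewrite !maxEle !minEle; move: (ab.1 0 i) (ab.2 0 i) => a b.
by repeat case: ifP; lra.
Qed.

(** Cutting every box of a cover along the hyperplane yields covers of the two parts with the same
    total volume, which gives the Caratheodory criterion. *)
Lemma half_space_measurable i (c : R) :
  measurable ([set x : Rn | c < x 0 i] : set T).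
Proof.
apply: le_caratheodory_measurable => X.
apply: le_ereal_inf_tmp => _ [F XF <-].
under eq_eseriesr do rewrite -(box_vol_cut i c).
rewrite nneseriesD => [|? _ _|? _ _]; rewrite ?box_vol_ge0//.
apply: leeD; apply: ereal_inf_lbound.
  exists (cut_lo i c \o F) => // x [/XF[k _ Fx] /= cx].
  by exists k => //; exact: box_cut_lo.
exists (cut_hi i c \o F) => // x [/XF[k _ Fx] /= /negP]; rewrite -leNgt => cx.
by exists k => //; exact: box_cut_hi.
Qed.

Lemma box_measurable (ab : Rn * Rn) : measurable (box ab : set T).
Proof.
pose F (i : 'I_n.+1) : set T :=
  [set x : Rn | ab.1 0 i < x 0 i] `&` ~` [set x : Rn | ab.2 0 i < x 0 i].
have -> : box ab = ~` \bigcup_i (~` F i).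
  rewrite setC_bigcup; apply/seteqP; split=> x abx i.
    move=> _; rewrite setCK; have /andP[ax xb] := abx i.
    by split=> //=; apply/negP; rewrite -leNgt.
  by have := abx i I; rewrite setCK => -[/= -> /negP]; rewrite -leNgt.
apply/measurableC/countable_bigcupT_measurable => // i.
by apply/measurableC/measurableI; [|apply/measurableC]; exact: half_space_measurable.
Qed.

Lemma lebesgue_outer_box (ab : Rn * Rn) : (leb (box ab) <= box_vol ab)%E.
Proof.
(* Padding by [(0, 0)], an empty box of volume 0. *)
pose F k : Rn * Rn := if k is 0%N then ab else (0, 0).
have <- : (\sum_(0 <= k <oo) box_vol (F k) = box_vol ab)%E.
  rewrite (nneseries_split 0%N 1%N) => [|k _]; last exact: box_vol_ge0.
  rewrite add0n big_nat1 eseries0 ?adde0// => -[//|k] _ _ /=.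
  by rewrite /box_vol (bigD1 ord0)//= subrr maxxx mul0r.
by apply: ereal_inf_lbound; exists F => // x abx; exists 0%N.
Qed.

Definition closed_box (a b : Rn) : set Rn := [set x | forall i, a 0 i <= x 0 i <= b 0 i].

Lemma compact_closed_box a b : compact (closed_box a b).
Proof.
rewrite (_ : closed_box a b = [set v : Rn | forall i, `[a 0 i, b 0 i]%classic (v ord0 i)]).
  by apply: (@rV_compact R n.+1 (fun i => `[a 0 i, b 0 i]%classic)) => i; exact: segment_compact.
by apply/seteqP; split=> v abv i; have := abv i; rewrite /= in_itv.
Qed.

Lemma lebesgue_outer_closed_box a b : (leb (closed_box a b) < +oo)%E.
Proof.
(* The lower corner is moved down by 1 so that the half-open box contains the closed one. *)
apply: (@le_lt_trans _ _ (box_vol (a - const_mx 1, b))); last by rewrite ltey.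
apply: le_trans (lebesgue_outer_box _); apply: le_outer_measure => x abx i.
have /andP[ax ->] := abx i; rewrite andbT !mxE (lt_le_trans _ ax)//.
by rewrite ltrBlDr ltrDl.
Qed.

(** * Open sets as countable unions of boxes *)

Section open_sets.
Variable U : set Rn.

(* The margin [d] leaves room for approximating a half-open box from outside
   by smooth functions supported in [U]. *)
Definition good_box (ab : Rn * Rn) : Prop :=
  exists2 d : R, 0 < d & closed_box ab.1 (ab.2 + const_mx d) `<=` U.

Lemma good_box_sub ab : good_box ab -> box ab `<=` U.
Proof.
move=> [d d0 abU] x abx; apply: abU => i; have /andP[ax xb] := abx i.
by rewrite ltW//= !mxE (le_trans xb)// lerDl ltW.
Qed.

Definition rat_box (t : 'rV[rat]_n.+1 * 'rV[rat]_n.+1) : Rn * Rn :=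
  (map_mx ratr t.1, map_mx ratr t.2).

Hypothesis oU : open U.

Lemma open_good_box x : U x -> exists2 t, good_box (rat_box t) & box (rat_box t) x.
Proof.
move=> Ux; have /nbhs_ballP[e /= e0 xU] : nbhs x U by apply: open_nbhs_nbhs.
(* The upper corner and the margin use e/4 each, the lower corner e/2, so the enlarged closed box
   stays within [e] of [x]. *)
have ea i : exists q : rat, ratr q \in `]x 0 i - e / 2, x 0 i[.
  by apply: rat_in_itvoo; rewrite ltrBlDr ltrDl divr_gt0.
have eb i : exists q : rat, ratr q \in `]x 0 i, x 0 i + e / 4[.
  by apply: rat_in_itvoo; rewrite ltrDl divr_gt0.
exists (\row_i sval (cid (ea i)), \row_i sval (cid (eb i))).
  exists (e / 4) => /=; first by rewrite divr_gt0.
  move=> y aby; apply: xU; rewrite /ball/= /mx_ball; split=> // i j.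
  rewrite (ord1 i); have := aby j; rewrite !mxE.
  case: cid => a /=; case: cid => b /=; rewrite !in_itv /= /ball/=.
  by move=> ? ? ?; rewrite ltr_norml; lra.
move=> i /=; rewrite !mxE.
case: cid => a /=; case: cid => b /=; rewrite !in_itv /=; lra.
Qed.

Lemma open_bigcup_box :
  U = \bigcup_t (if `[< good_box (rat_box t) >] then box (rat_box t) else set0).
Proof.
apply/seteqP; split=> [x /open_good_box[t gt tx]|x [t _]].
  by exists t => //; rewrite asboolT.
by case: asboolP => // /good_box_sub; apply.
Qed.

Lemma open_lebesgue_measurable : measurable (U : set T).
Proof.
rewrite open_bigcup_box; apply: (@countable_bigcupT_measurable _ T) => // t.
by case: ifP => _; [exact: box_measurable|exact: measurable0].
Qed.

Lemma good_box_cover : exists B : nat -> Rn * Rn,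
  (forall k, box (B k) = set0 \/ good_box (B k)) /\ U = \bigcup_k box (B k).
Proof.
(* Integers that do not encode a good rational box are sent to [(0, 0)], whose half-open box is
   empty. *)
pose B k : Rn * Rn := if choice.unpickle k is Some t then
   if `[< good_box (rat_box t) >] then rat_box t else (0, 0) else (0, 0).
have box0 : box (0, 0 : Rn) = set0.
  apply/seteqP; split=> // x /(_ ord0) /=; rewrite mxE => /andP[/lt_le_trans h /h].
  by rewrite ltxx.
exists B; split=> [k|].
  rewrite /B; case: choice.unpickle => [t|]; last by left.
  by case: asboolP => [gt|_]; [right|left].
apply/seteqP; split=> [x /open_good_box[t gt tx]|x [k _]].
  by exists (choice.pickle t) => //; rewrite /B choice.pickleK asboolT.
rewrite /B; case: choice.unpickle => [t|]; last by rewrite box0.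
by case: asboolP => [/good_box_sub gt /gt//|_]; rewrite box0.
Qed.

End open_sets.

Lemma continuous_lebesgue_measurable (U : set Rn) (f : Rn -> R) : open U ->
  {within U, continuous f} -> measurable_fun (U : set T) f.
Proof.
move=> oU; rewrite continuous_open_subspace// => /(continuous_inP _ oU) cf mU.
apply: (measurability _ (RGenOpens.measurableE R)) => //.
move=> _ [_ [a [b ->]] <-]; apply: open_lebesgue_measurable.
exact/cf/interval_open.
Qed.

End lebesgue_rV_sets.

(** * The modular on a general measure space *)

Section modular_integral.
Context {R : realType} d (T : measurableType d) (mu : {measure set T -> \bar R}).
Implicit Types u v w : T -> R.

(** [fun_modular] is, by conversion, the case of [lebesgue_rV]. *)
Definition int_modular (p : T -> R) (D : set T) u : \bar R :=
  \int[mu]_(x in D) (`|u x| `^ p x)%:E.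

(** The preimages under [u] and [v] differ only inside a null set, all of whose subsets are
    measurable by completeness. *)
Lemma measurable_fun_ae_eq (D : set T) u v : measure_is_complete mu -> measurable D ->
  measurable_fun D u -> u = v %[ae mu in D] ->
  measurable_fun D v.
Proof.
move=> cmu mD mu_ [N [mN N0 uvN]] _ Y mY.
have -> : D `&` v @^-1` Y = ((D `&` u @^-1` Y) `&` ~` N) `|` (D `&` v @^-1` Y `&` N).
  apply/seteqP; split=> [x [Dx vx]|x [[[Dx ux] Nx]|[[Dx vx] Nx]]] //.
    have [Nx|Nx] := pselect (N x); [by right|left]; split=> //; split=> //.
    have /contrapT uv : ~ ~ (D x -> u x = v x) by move=> h; exact/Nx/uvN.
    by rewrite /preimage/= uv.
  split=> //; have /contrapT uv : ~ ~ (D x -> u x = v x) by move=> h; exact/Nx/uvN.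
  by rewrite /preimage/= -uv.
apply: measurableU.
  by apply: measurableI; [exact: mu_|exact: measurableC].
apply: cmu.
by exists N; split=> // x [].
Qed.

Variables (p : T -> R) (D : set T).
Hypotheses (mD : measurable D) (mp : measurable_fun D p).
Hypothesis p1 : forall x, D x -> 1 <= p x.
Local Notation rho := (int_modular p D).
Local Notation measD u := (measurable_fun D u).

Let p0 x : D x -> 0 <= p x. Proof. by move=> /p1; exact: le_trans. Qed.
Let pN0 x : D x -> p x != 0.
Proof. by move=> /p1 h; rewrite gt_eqF// (lt_le_trans _ h). Qed.

Lemma measurable_norm_powR u : measD u -> measD (fun x => `|u x| `^ p x).
Proof.
(* [powR] is a case distinction: where [u] vanishes the value is 0, as the exponent is not 0 on [D];
   elsewhere it is the exponential of p ln|u|. *)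
move=> mu_; rewrite /powR; apply: (measurable_fun_if mD).
- by apply: measurable_fun_eqr; [exact: measurableT_comp|exact: measurable_cst].
- apply: (@eq_measurable_fun _ _ T (measurableTypeR R) _ (fun=> 0 : R)); last exact: measurable_cst.
  by move=> x; rewrite inE => -[/pN0 /negbTE ->].
- apply: (@measurable_funS _ _ T _ D) => //.
  apply: measurableT_comp => //; apply: measurable_funM => //.
  by apply: measurableT_comp => //; exact: measurableT_comp.
Qed.

Let measurable_integrand u : measD u ->
  measurable_fun D (fun x => (`|u x| `^ p x)%:E).
Proof. by move=> /measurable_norm_powR mu_; exact/measurable_EFinP. Qed.

Lemma le_int_modular u v : measD u -> measD v ->
  (forall x, D x -> `|u x| <= `|v x|) -> (rho u <= rho v)%E.
Proof.
move=> mu_ mv uv; apply: ge0_le_integral => //.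
- exact: measurable_integrand.
- exact: measurable_integrand.
- by move=> x Dx; rewrite lee_fin ge0_ler_powR ?nnegrE ?p0 ?uv.
Qed.

Lemma ae_eq_int_modular u v : measure_is_complete mu -> measD u ->
  u = v %[ae mu in D] -> rho u = rho v.
Proof.
move=> cmu mu_ uv; have mv := measurable_fun_ae_eq cmu mD mu_ uv.
apply: ge0_ae_eq_integral => //; try exact: measurable_integrand;
  try by move=> x _; rewrite lee_fin powR_ge0.
have aeF : Filter (almost_everywhere mu) by exact: ae_filter_ringOfSetsType.
by move: uv; apply: filterS => x uv Dx; rewrite uv.
Qed.

Lemma int_modularD_lty u v (l m : R) : 0 < l -> 0 < m ->
  measD u -> measD v -> (rho (fun x => l * u x)%R < +oo)%E ->
  (rho (fun x => m * v x)%R < +oo)%E ->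
  (rho (fun x => Num.min l m / 2 * (u x + v x))%R < +oo)%E.
Proof.
move=> l0 m0 mu_ mv lu mv_.
apply: le_lt_trans (lte_add_pinfty lu mv_).
have mZ (k : R) w : measD w -> measD (fun x => k * w x).
  by move=> mw; apply: measurable_funM.
rewrite -ge0_integralD//; try by move=> x _; rewrite lee_fin powR_ge0.
- apply: ge0_le_integral => //.
  + by apply: measurable_integrand; apply: mZ; exact: measurable_funD.
  + by apply: emeasurable_funD; apply: measurable_integrand; exact: mZ.
  + by move=> x Dx; rewrite -EFinD lee_fin; apply: powR_normD_le => //; exact: p0.
- by apply: measurable_integrand; exact: mZ.
- by apply: measurable_integrand; exact: mZ.
Qed.

(** Dominated convergence with majorant |w|^p. Once |v_k(x)| is below 1, its power is at most
    |v_k(x)|, because the exponent is at least 1. *)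
Lemma int_modular_cvg0 (v : nat -> T -> R) w :
  (forall k, measD (v k)) -> measD w -> (rho w < +oo)%E ->
  (forall k x, D x -> `|v k x| <= w x) ->
  (forall x, D x -> v ^~ x @ \oo --> (0 : R)) ->
  rho (v k) @[k --> \oo] --> 0%E.
Proof.
move=> mv mw rw vw v0.
have -> : (0 = \int[mu]_(x in D) 0)%E by rewrite integral0.
apply: (@dominated_cvg _ _ _ mu _ mD _ (cst 0%E) (fun x => (`|w x| `^ p x)%:E)).
- by move=> k; exact: measurable_integrand.
- move=> x Dx /=.
  apply: cvg_EFin; first by apply: nearW.
  have /cvgrPdist_lt vx := v0 x Dx.
  apply/cvgrPdist_lt => e e0.
  have e1 : 0 < Num.min e 1 by rewrite lt_min e0 ltr01.
  near=> k.
  have : `|0 - v k x| < Num.min e 1 by near: k; exact: vx.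
  rewrite /= !sub0r !normrN lt_min => /andP[ve v1].
  rewrite ger0_norm ?powR_ge0//.
  have [->|vk0] := eqVneq (v k x) 0; first by rewrite normr0 powR0 ?pN0.
  by rewrite (le_lt_trans _ ve)// ge1r_powR ?p1// normr_gt0 vk0/= ltW.
- by [].
- apply/integrableP; split; first exact: measurable_integrand.
  apply: le_lt_trans rw; rewrite le_eqVlt; apply/orP; left; apply/eqP.
  by apply: eq_integral => x _; rewrite gee0_abs// lee_fin powR_ge0.
- move=> k x Dx; rewrite gee0_abs ?lee_fin ?powR_ge0//.
  rewrite ge0_ler_powR ?nnegrE ?p0//.
  by rewrite (le_trans (vw _ _ Dx))// ler_norm.
Unshelve. all: by end_near. Qed.

End modular_integral.

(** * Classes modulo almost everywhere equality *)

Section lebesgue_modular.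
Context {R : realType} {n : nat}.
Local Notation Rn := 'rV[R]_n.+1.
Local Notation T := (@lebesgue_type R n).
Local Notation mu := (@lebesgue_rV R n).
Implicit Types u v w : Rn -> R.
Variables (p : Rn -> R) (D : set Rn).
Hypotheses (mD : measurable (D : set T)) (mp : measurable_fun (D : set T) p).
Hypothesis p1 : forall x, D x -> 1 <= p x.
Local Notation rho := (fun_modular p D).
Local Notation measD u := (measurable_fun (D : set T) u).

(** The representative chosen by [repr] is almost everywhere equal to [u], hence measurable because
    the measure is complete, and has the same integral. *)
Lemma Lp_modular_to_class u : measD u -> Lp_modular p D (to_class D u) = rho u.
Proof.
move=> mu_; apply/esym/(ae_eq_int_modular mD mp p1).
- exact: measure_is_complete_caratheodory.
- exact: mu_.
- by apply/to_classP; rewrite /to_class reprK.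
Qed.

Lemma to_classD u v : to_class D (u + v) = to_class D u + to_class D v.
Proof. exact: raddfD. Qed.

Lemma to_classB u v : to_class D (u - v) = to_class D u - to_class D v.
Proof. exact: raddfB. Qed.

Lemma Lp_setD c d : Lp_set p D c -> Lp_set p D d -> Lp_set p D (c + d).
Proof.
move=> [u [<- mu_ [l l0 lu]]] [v [<- mv [m m0 mv_]]].
exists (u + v); split; first exact: to_classD.
  exact: measurable_funD.
exists (Num.min l m / 2); first by rewrite divr_gt0// lt_min l0.
exact: (int_modularD_lty mD mp p1 l0 m0 mu_ mv lu mv_).
Qed.

End lebesgue_modular.

(** * Density, from indicators of boxes to general functions *)

Section modular_density.
Context {R : realType} d (T : measurableType d) (mu : {measure set T -> \bar R}).
Variables (p : T -> R) (D : set T).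
Hypotheses (mD : measurable D) (mp : measurable_fun D p).
Hypothesis p1 : forall x, D x -> 1 <= p x.
Local Notation rho := (int_modular mu p D).
Local Notation measD u := (measurable_fun D u).
Implicit Types (u v : T -> R) (E F : set T).

(* [clo u] stands for: the class of [u] is in the closure of the test functions. *)
Variable clo : (T -> R) -> Prop.
Hypothesis clo_add : forall u v, measD u -> measD v -> clo u -> clo v -> clo (u + v).
Hypothesis clo_lim : forall u, measD u -> (rho u < +oo)%E ->
  (forall e : R, 0 < e -> exists v, [/\ measD v, clo v & (rho (v - u)%R < e%:E)%E]) ->
  clo u.

(** Boxes enter only through the properties below. Bounded exponent and finite measure give finite
    modular to multiples of indicators of their measurable subsets; the covers play the role of
    outer regularity. *)
Variable boxes : set (set T).
Hypothesis boxes_measurable : forall E, boxes E -> measurable E.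
Hypothesis boxesI : forall E F, boxes E -> boxes F -> boxes (E `&` F).
Hypothesis boxes_sub : forall E, boxes E -> E `<=` D.
Hypothesis boxes_p : forall E, boxes E -> exists P : R, forall x, E x -> p x <= P.
Hypothesis boxes_fin : forall E, boxes E -> (mu E < +oo)%E.
Hypothesis boxes_clo : forall E (c : R), boxes E -> clo (fun x => c * \1_E x).
Hypothesis boxes_cover : forall B E (e : R), boxes B -> measurable E -> E `<=` B ->
  0 < e -> exists F : nat -> set T,
    [/\ forall k, boxes (F k), E `<=` \bigcup_k F k,
        \bigcup_k F k `<=` B & (mu (\bigcup_k F k) <= mu E + e%:E)%E].
Hypothesis boxes_exhaust : exists B : nat -> set T,
  (forall k, boxes (B k)) /\ D = \bigcup_k B k.

Let measZ1 (c : R) E : measurable E -> measD (fun x => c * \1_E x).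
Proof. by move=> mE; apply: measurable_funM => //; exact: measurable_indic. Qed.

Let p0 x : D x -> p x != 0.
Proof. by move=> /p1 h; rewrite gt_eqF// (lt_le_trans _ h). Qed.

(** The base is raised from |c| to 1 + |c| because monotonicity of the power in the exponent asks
    for a base at least 1. *)
Lemma int_modular_indic_le (c P : R) E : measurable E -> E `<=` D ->
  (forall x, E x -> p x <= P) ->
  (rho (fun x => c * \1_E x)%R <= ((1 + `|c|) `^ P)%:E * mu E)%E.
Proof.
move=> mE ED EP; rewrite -[X in (_ * mu X)%E](setIidl ED) -integral_indic//.
rewrite -ge0_integralZl ?lee_fin ?powR_ge0//; last first.
  by apply/measurable_EFinP; exact: measurable_indic.
apply: ge0_le_integral => //.
- by apply/measurable_EFinP/(measurable_norm_powR mD mp p1)/measZ1.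
- by apply: measurable_funeM; apply/measurable_EFinP; exact: measurable_indic.
- move=> x Dx; rewrite -EFinM lee_fin indicE.
  case: (boolP (x \in E)) => [/set_mem Ex|_]; last first.
    by rewrite !mulr0 normr0 powR0// p0.
  rewrite !mulr1 (@le_trans _ _ ((1 + `|c|) `^ p x))//.
    by rewrite ge0_ler_powR ?nnegrE ?addr_ge0 ?lerDr// (le_trans _ (p1 Dx)).
  by apply: ler_powR; [rewrite lerDl|exact: EP].
Qed.

Let rho_boxes (c : R) E F : boxes E -> measurable F -> F `<=` E ->
  (rho (fun x => c * \1_F x)%R < +oo)%E.
Proof.
move=> bE mF FE; have [P EP] := boxes_p bE.
apply: le_lt_trans (int_modular_indic_le _ mF _ (fun x Fx => EP x (FE x Fx))) _.
  exact: subset_trans (boxes_sub bE).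
rewrite lte_mul_pinfty ?lee_fin ?powR_ge0//.
by rewrite (le_lt_trans _ (boxes_fin bE))// le_measure ?inE//; exact: boxes_measurable.
Qed.

Lemma clo_dominated (v : nat -> T -> R) u w : (forall k, measD (v k)) ->
  (forall k, clo (v k)) -> measD u -> (rho u < +oo)%E ->
  measD w -> (rho w < +oo)%E -> (forall k x, D x -> `|v k x - u x| <= w x) ->
  (forall x, D x -> v ^~ x @ \oo --> u x) -> clo u.
Proof.
move=> mv cv mu_ ru mw rw vw vu; apply: clo_lim => // e e0.
have vu0 x : D x -> (fun k => (v k - u) x) @ \oo --> (0 : R).
  by move=> Dx; rewrite -(subrr (u x)); apply: cvgB; [exact: vu|exact: cvg_cst].
have [|N _ /(_ N (leqnn N)) Ne] := cvge0_near_lt e0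
  (int_modular_cvg0 mD mp p1 (v := fun k => v k - u) _ mw rw vw vu0).
  by move=> k; exact: measurable_funB.
by exists (v N).
Qed.

Lemma clo_sum (I : Type) (r : seq I) (F : I -> T -> R) :
  (forall i, measD (F i)) -> (forall i, clo (F i)) ->
  clo (fun x => \sum_(i <- r) F i x).
Proof.
move=> mF cF; elim: r => [|i r ih].
  (* The zero function is taken as 0 times the indicator of a box, a form covered by [boxes_clo]. *)
  have [B [bB _]] := boxes_exhaust.
  rewrite (_ : (fun _ => _) = (fun x => 0 * \1_(B 0%N) x)); first exact: boxes_clo.
  by apply/funext => x; rewrite big_nil mul0r.
rewrite (_ : (fun _ => _) = F i + (fun x => \sum_(i <- r) F i x)).
  by apply: clo_add => //; exact: measurable_sum.
by apply/funext => x; rewrite big_cons.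
Qed.

(** All real factors are required, so that -c is available when a subset is removed. *)
Definition clo_set E := measurable E /\ forall c : R, clo (fun x => c * \1_E x).

Lemma clo_set_box E : boxes E -> clo_set E.
Proof. by move=> bE; split=> [|c]; [exact: boxes_measurable|exact: boxes_clo]. Qed.

Lemma clo_setU E F : clo_set E -> clo_set F -> E `&` F = set0 -> clo_set (E `|` F).
Proof.
move=> [mE cE] [mF cF] EF; split=> [|c]; first exact: measurableU.
rewrite (_ : (fun _ => _) = (fun x => c * \1_E x) + (fun x => c * \1_F x)).
  by apply: clo_add => //; exact: measZ1.
apply/funext => x; rewrite -[RHS]/(c * \1_E x + c * \1_F x) -mulrDr; congr (_ * _).
rewrite !indicE in_setU; have [/set_mem Ex|_] := boolP (x \in E); last by rewrite add0r.
by rewrite memNset ?addr0// => Fx; have : (E `&` F) x by []; rewrite EF.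
Qed.

Lemma clo_setD E F : clo_set E -> clo_set F -> F `<=` E -> clo_set (E `\` F).
Proof.
move=> [mE cE] [mF cF] FE; split=> [|c]; first exact: measurableD.
rewrite (_ : (fun _ => _) = (fun x => c * \1_E x) + (fun x => - c * \1_F x)).
  by apply: clo_add => //; exact: measZ1.
apply/funext => x; rewrite -[RHS]/(c * \1_E x + - c * \1_F x) mulNr -mulrBr; congr (_ * _).
rewrite !indicE in_setD; have [/set_mem/FE/mem_set ->|_] := boolP (x \in F).
  by rewrite subrr.
by rewrite andbT subr0.
Qed.

Lemma clo_set0 : clo_set set0.
Proof.
have [B [bB _]] := boxes_exhaust.
by rewrite -(setDv (B 0%N)); apply: clo_setD => //; exact: clo_set_box.
Qed.

Lemma clo_set_bigcup_lt N (F : nat -> set T) : (forall k, boxes (F k)) ->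
  clo_set (\bigcup_(k < N) F k).
Proof.
elim: N F => [F bF|N ih F bF]; first by rewrite II0 bigcup_set0; exact: clo_set0.
rewrite IIS bigcup_setU bigcup_set1; set U := \bigcup_(k < N) F k.
(* Only the part of [F N] outside the earlier sets is added. What is removed from it is the union of
   the intersections of [F k] with [F N], again [N] boxes; hence the induction over all families
   [F]. *)
have -> : U `|` F N = U `|` (F N `\` (U `&` F N)).
  by apply/seteqP; split=> x; have [?|?] := pselect (U x) => -[?|]; (try by left);
    [right; split=> // -[]|case=> ? _; right].
apply: clo_setU; first exact: ih.
  apply: clo_setD; [exact: clo_set_box| |exact: subIsetr].
  by rewrite setI_bigcupl; apply: ih => k; exact: boxesI.
by apply/seteqP; split=> // x [Ux [Fx []]].
Qed.

Lemma clo_set_bigcup (F : nat -> set T) B : boxes B -> (forall k, boxes (F k)) ->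
  \bigcup_k F k `<=` B -> clo_set (\bigcup_k F k).
Proof.
move=> bB bF FB; have mF : measurable (\bigcup_k F k).
  by apply: bigcupT_measurable => k; exact: boxes_measurable.
have mFN N : measurable (\bigcup_(k < N) F k) by have [] := clo_set_bigcup_lt N bF.
have FNF N : \bigcup_(k < N) F k `<=` \bigcup_k F k by move=> x [k _ Fx]; exists k.
split=> // c.
(* The partial unions stabilise at each point, and |c| times the indicator of [B] dominates the
   errors. *)
apply: (@clo_dominated (fun N x => c * \1_(\bigcup_(k < N) F k) x) _ (fun x => `|c| * \1_B x)).
- by move=> N; exact: measZ1.
- by move=> N; have [_] := clo_set_bigcup_lt N bF; apply.
- exact: measZ1.
- exact: rho_boxes bB mF FB.
- by apply: measZ1; exact: boxes_measurable.
- by apply: (rho_boxes _ bB) => //; exact: boxes_measurable.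
- move=> N x Dx; rewrite -mulrBr normrM ler_wpM2l// !indicE.
  have [/set_mem/FNF xF|_] := boolP (x \in \bigcup_(k < N) F k).
    by rewrite (mem_set xF) subrr normr0.
  by case: (boolP (x \in \bigcup_k F k)) => [/set_mem/FB/mem_set ->|_];
    rewrite sub0r normrN ?normr1 ?normr0.
- move=> x Dx; apply: cvg_near_cst; rewrite !indicE.
  have [/set_mem [k _ Fx]|nF] := boolP (x \in \bigcup_k F k).
    by exists k.+1 => // N /= kN; rewrite indicE mem_set//; exists k.
  apply: nearW => N; rewrite indicE memNset// => /FNF/mem_set.
  exact/negP.
Qed.

Lemma clo_set_sub_box E B : boxes B -> measurable E -> E `<=` B -> clo_set E.
Proof.
move=> bB mE EB; split=> // c; apply: clo_lim; first exact: measZ1.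
  exact: rho_boxes bB mE EB.
move=> e e0; have [P BP] := boxes_p bB.
(* Inside [B], the modular of [c] times an indicator is at most [C] times the measure, so an excess
   measure e/(2C) costs at most e/2. *)
pose C := (1 + `|c|) `^ P; have C0 : 0 < C by rewrite powR_gt0// ltr_wpDr.
have eC : 0 < e / (2 * C) by rewrite divr_gt0// mulr_gt0.
have [F [bF EF FB muF]] := boxes_cover bB mE EB eC.
set U := \bigcup_k F k in EF FB muF.
have [mU cU] : clo_set U by exact: clo_set_bigcup bB bF FB.
exists (fun x => c * \1_U x); split; [exact: measZ1|exact: cU|].
have -> : (fun x => c * \1_U x) - (fun x => c * \1_E x) = (fun x => c * \1_(U `\` E) x).
  apply/funext => x; rewrite -[LHS]/(c * \1_U x - c * \1_E x) -mulrBr; congr (_ * _).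
  rewrite !indicE in_setD; have [/set_mem/EF/mem_set ->|_] := boolP (x \in E).
    by rewrite subrr.
  by rewrite andbT subr0.
have UEB : U `\` E `<=` B by move=> x [/FB].
apply: le_lt_trans (int_modular_indic_le c _ _ (fun x UEx => BP x (UEB x UEx))) _.
- exact: measurableD.
- exact: subset_trans UEB (boxes_sub bB).
- have Efin : mu E \is a fin_num.
    rewrite ge0_fin_numE// (le_lt_trans _ (boxes_fin bB))// le_measure ?inE//.
    exact: boxes_measurable.
  have : (mu (U `\` E) <= (e / (2 * C))%:E)%E.
    rewrite measureD//; last first.
      by rewrite (le_lt_trans muF)// -ge0_fin_numE ?adde_ge0 ?lee_fin ?(ltW eC)// fin_numD Efin.
    by rewrite setIC (setIidl EF) leeBlDl.
  move/(lee_wpmul2l (_ : 0 <= C%:E)%E) => h.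
  apply: le_lt_trans (h _) _; first by rewrite lee_fin ltW.
  rewrite -EFinM lte_fin (_ : C * _ = e / 2); first by rewrite ltr_pdivrMr// ltr_pMr// ltr1n.
  by field; rewrite gt_eqF.
Qed.

Lemma clo_set_sub_boxes (B : nat -> set T) N E : (forall k, boxes (B k)) ->
  measurable E -> E `<=` \bigcup_(k < N) B k -> clo_set E.
Proof.
move=> bB; elim: N E => [E mE|N ih E mE].
  by rewrite II0 bigcup_set0 subset0 => ->; exact: clo_set0.
rewrite IIS bigcup_setU bigcup_set1 => EB.
set U := \bigcup_(k < N) B k in ih EB *.
have mU : measurable U.
  by apply: bigcup_measurable => k _; exact: boxes_measurable.
rewrite -(setUIDK E U); apply: clo_setU.
- by apply: ih; [exact: measurableI|exact: subIsetr].
- apply: (clo_set_sub_box (bB N)); first exact: measurableD.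
  by move=> x [/EB[]].
- by apply/seteqP; split=> // x [[_ ?] []].
Qed.

Import HBNNSimple.

Lemma clo_nnsfun (h : {nnsfun T >-> R}) (e : R) (B : nat -> set T) N :
  (forall k, boxes (B k)) ->
  clo (fun x => e * h x * \1_(\bigcup_(k < N) B k) x).
Proof.
move=> bB; set U := \bigcup_(k < N) B k.
have mU : measurable U.
  by apply: bigcup_measurable => k _; exact: boxes_measurable.
pose S := fset_set (range h).
have mh y : measurable (h @^-1` [set y] `&` U).
  by apply: measurableI => //; exact: measurable_funPTI.
(* The simple function is split along its finitely many values; each level set, cut to [U], lies in
   finitely many boxes. *)
rewrite (_ : (fun _ => _) = fun x =>
    \sum_(i < #|` S|) (e * S`_i) * \1_(h @^-1` [set S`_i] `&` U) x).
  apply: clo_sum => i; first exact: measZ1.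
  have [_] := clo_set_sub_boxes bB (mh S`_i) (@subIsetr _ _ _).
  by apply.
apply/funext => x; rewrite fimfunEord -/S mulr_sumr mulr_suml; apply: eq_bigr => i _.
by rewrite indicI /= !mulrA.
Qed.

(** The factor [e] is a sign, so that positive and negative parts are treated together. *)
Lemma clo_ge0 u (e : R) : `|e| = 1 -> measD u -> (forall x, D x -> 0 <= u x) ->
  (rho u < +oo)%E -> clo (fun x => e * u x).
Proof.
move=> e1 mu_ u0 ru; have [B [bB DB]] := boxes_exhaust.
have Emu : measurable_fun D (EFin \o u) by exact/measurable_EFinP.
pose U N := \bigcup_(k < N) B k.
have mU N : measurable (U N).
  by apply: bigcup_measurable => k _; exact: boxes_measurable.
have Eu0 x : D x -> (0 <= (EFin \o u) x)%E by move=> Dx; rewrite lee_fin u0.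
have [h [hu hcvg]] : exists h : nat -> {nnsfun T >-> R},
    (forall N x, D x -> h N x <= u x) /\
    (forall x, D x -> (h N x @[N --> \oo] --> u x)).
  exists (nnsfun_approx mD Emu); split=> [N x Dx|x Dx].
    by rewrite -lee_fin nnsfun_approxE; exact: le_approx.
  by have /fine_cvgP[] := cvg_nnsfun_approx mD Emu Eu0 Dx.
have reu : (rho (fun x => e * u x)%R = rho u).
  by apply: eq_integral => x _; rewrite normrM e1 mul1r.
(* Up to the sign, the approximants lie between 0 and [u], so [u] itself dominates the errors. *)
apply: (@clo_dominated (fun N x => e * h N x * \1_(U N) x) _ u).
- move=> N; apply: measurable_funM; last exact: measurable_indic.
  by apply: measurable_funM; [exact: measurable_cst|exact: measurable_funP].
- by move=> N; exact: clo_nnsfun.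
- by apply: measurable_funM; [exact: measurable_cst|exact: mu_].
- by rewrite reu.
- exact: mu_.
- exact: ru.
- move=> N x Dx; rewrite -mulrA -mulrBr normrM e1 mul1r.
  have h0 : 0 <= h N x by [].
  have := hu N x Dx; have := u0 x Dx.
  rewrite indicE; case: (x \in U N) => /= ? ?; rewrite ler_norml; lra.
- move=> x Dx; have := Dx; rewrite DB => -[k _ Bx].
  apply: cvg_trans (cvgMl_tmp (a := e) (hcvg x Dx)).
  apply: near_eq_cvg; exists k.+1; first by [].
  move=> N /= kN; rewrite indicE mem_set; first by rewrite mulr1.
  by exists k.
Qed.

Lemma clo_finite_modular u : measD u -> (rho u < +oo)%E -> clo u.
Proof.
move=> mu_ ru.
have rle v : measD v -> (forall x, D x -> `|v x| <= `|u x|) -> (rho v < +oo)%E.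
  by move=> mv vu; apply: le_lt_trans ru; exact: (le_int_modular mu mD mp p1 mv mu_ vu).
have mpos : measD (u ^\+) by exact: measurable_funrpos.
have mneg : measD (u ^\-) by exact: measurable_funrneg.
have -> : u = (fun x => 1 * u^\+ x) + (fun x => -1 * u^\- x).
  by apply/funext => x; rewrite -[RHS]/(_ * _ + _ * _) mul1r mulN1r -{1}(funrposBneg u).
apply: clo_add; [exact: measurable_funM|exact: measurable_funM| |].
- apply: clo_ge0; [by rewrite normr1|exact: mpos|by move=> x _; exact: funrpos_ge0|].
  apply: rle; first exact: mpos.
  move=> x Dx; rewrite ger0_norm; last exact: funrpos_ge0.
  by rewrite ge_max ler_norm normr_ge0.
- apply: clo_ge0; [by rewrite normrN normr1|exact: mneg|by move=> x _; exact: funrneg_ge0|].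
  apply: rle; first exact: mneg.
  move=> x Dx; rewrite ger0_norm; last exact: funrneg_ge0.
  by rewrite ge_max ler_normr lexx orbT normr_ge0.
Qed.

Lemma clo_modular u (l : R) : 0 < l -> measD u -> (rho (fun x => l * u x)%R < +oo)%E ->
  clo u.
Proof.
(* As for sequences: u/m is dominated by l u, and [m] copies of it add up to [u]. *)
move=> l0 mu_ rlu; pose m := (Num.truncn l^-1).+1.
pose v : T -> R := fun x => m%:R^-1 * u x.
have mv : measD v by exact: measurable_funM.
have cv : clo v.
  apply: clo_finite_modular; first exact: mv.
  apply: le_lt_trans rlu; apply: (le_int_modular mu mD mp p1 mv).
    by apply: measurable_funM; [exact: measurable_cst|exact: mu_].
  move=> x Dx.
  rewrite !normrM ler_wpM2r// !ger0_norm ?(ltW l0)// invf_ple ?posrE// ltW//.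
  by rewrite truncnS_gt.
rewrite (_ : u = fun x => \sum_(i < m) v x); first exact: clo_sum.
apply/funext => x; rewrite sumr_const card_ord /v -[RHS]mulr_natr mulrAC mulVf ?mul1r//.
by rewrite pnatr_eq0.
Qed.

End modular_density.

(** * Functions flat at the origin *)

Section flat_exponential.
Context {R : realType}.
Implicit Types (Q : {poly R}) (t : R).

(** Letting the polynomial [Q] vary makes the family closed under differentiation. *)
Definition flat_exp Q t : R := if 0 < t then Q.[t^-1] * expR (- t^-1) else 0.

(** With s = 1/t, the derivative of Q(s) exp(-s) in t is s^2 (Q(s) - Q'(s)) exp(-s). *)
Definition flat_exp_deriv Q : {poly R} := 'X^2 * (Q - Q^`()).

(** With s = 1/t, each s^(i+1) is at most (i+1)! exp(s); summed over the coefficients of [Q] this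
    bounds |Q(s)| s by C exp(s). Adding 1 to the constant makes it positive even for Q = 0. *)
Lemma flat_exp_bound Q : exists2 C : R, 0 < C & forall t, `|flat_exp Q t| <= C * `|t|.
Proof.
pose C := \sum_(i < size Q) `|Q`_i| * (i.+1)`!%:R.
have C0 : 0 <= C by apply: sumr_ge0 => i _; rewrite mulr_ge0.
exists (C + 1) => [|t]; first by rewrite ltr_wpDl.
rewrite /flat_exp; case: ifPn => t0; last by rewrite normr0 mulr_ge0// addr_ge0.
have s0 : 0 < t^-1 by rewrite invr_gt0.
rewrite normrM (gtr0_norm (expR_gt0 _)) expRN ler_pdivrMr ?expR_gt0//.
rewrite (gtr0_norm t0) mulrAC -ler_pdivrMr//.
apply: (@le_trans _ _ (C * expR t^-1)); last by rewrite ler_wpM2r ?expR_ge0// lerDl.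
rewrite horner_coef ler_pdivrMr// -[X in _ <= X * _]mulrC.
apply: le_trans (ler_norm_sum _ _ _) _.
rewrite -ler_pdivrMr// mulr_sumr mulr_suml; apply: ler_sum => i _.
rewrite normrM mulrCA -mulrA ler_wpM2l// ger0_norm ?exprn_ge0 ?(ltW s0)//.
rewrite -exprSr -ler_pdivrMr ?ltr0n ?fact_gt0//.
by apply: le_trans (expR_ge1Dxn i (ltW s0)); rewrite lerDr.
Qed.

Lemma is_derive_flat_exp Q t : is_derive t 1 (flat_exp Q) (flat_exp (flat_exp_deriv Q) t).
Proof.
have [t0|t0|<-] := ltgtP 0 t.
- have -> : flat_exp (flat_exp_deriv Q) t =
      Q.[t^-1] * (- (- t ^- 2) * expR (- t^-1)) + expR (- t^-1) * (- t ^- 2 * Q^`().[t^-1]).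
    rewrite /flat_exp t0 /flat_exp_deriv hornerM hornerXn hornerD hornerN -exprVn.
    by ring.
  apply: (@near_eq_is_derive _ _ _ (fun t => Q.[t^-1] * expR (- t^-1))).
    near=> s; rewrite /flat_exp ifT//; near: s; exact: lt_nbhsr.
  have t_neq0 : id t != 0 by rewrite gt_eqF.
  have dV : is_derive t 1 (fun s : R => s^-1) (- t ^- 2).
    by apply: is_derive_eq (is_deriveV t_neq0 (is_derive_id t (1 : R))) _; rewrite [LHS]mulr1.
  have dQ : is_derive t 1 (horner Q \o (fun s : R => s^-1)) (Q^`().[t^-1] * - t ^- 2).
    exact: is_derive1_comp.
  have dE : is_derive t 1 (expR \o (fun s : R => - s^-1)) (expR (- t^-1) * - - t ^- 2).
    exact: is_derive1_comp.
  by apply: is_derive_eq (is_deriveM dQ dE) _; rewrite /GRing.scale /=; ring.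
- have -> : flat_exp (flat_exp_deriv Q) t = 0 by rewrite /flat_exp ltNge (ltW t0).
  apply: (@near_eq_is_derive _ _ _ (cst 0)).
    near=> s; rewrite /flat_exp ifF//; apply/negbTE; rewrite -leNgt ltW//.
    near: s; exact: lt_nbhsl.
- have -> : flat_exp (flat_exp_deriv Q) 0 = 0 by rewrite /flat_exp ltxx.
  (* The division by h in the difference quotient is absorbed by the polynomial: the quotient is
     [flat_exp ('X * Q) h], at most C|h|. *)
  have [C C0 QC] := flat_exp_bound ('X * Q).
  suff : h^-1 *: (flat_exp Q (h *: 1 + 0) - flat_exp Q 0) @[h --> 0^'] --> (0 : R).
    move=> h0; apply: DeriveDef; first by apply/cvg_ex; exists 0.
    exact/cvg_lim.
  apply/cvgrPdist_lt => e e0; near=> h.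
  have h0 : h != 0 by near: h; exact: nbhs_dnbhs_neq.
  rewrite sub0r normrN [h *: 1]mulr1 addr0 {2}/flat_exp ltxx subr0 normrZ.
  have -> : flat_exp Q h = h * flat_exp ('X * Q) h.
    by rewrite /flat_exp; case: ifP => _; rewrite ?mulr0// hornerM hornerX !mulrA divff// mul1r.
  rewrite normrM mulrA -normrM mulVf// normr1 mul1r.
  apply: le_lt_trans (QC h) _.
  rewrite mulrC -ltr_pdivlMr//; near: h.
  apply: dnbhs0_lt; exact: divr_gt0.
Unshelve. all: by end_near. Qed.

Lemma continuous_flat_exp Q : continuous (flat_exp Q).
Proof.
move=> t; apply/differentiable_continuous/derivable1_diffP.
by have [] := is_derive_flat_exp Q t.
Qed.

Lemma flat_exp_neq0 Q t : flat_exp Q t != 0 -> 0 < t.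
Proof. by rewrite /flat_exp; case: ifP => //; rewrite eqxx. Qed.

Lemma flat_exp1_ge0 t : 0 <= flat_exp 1 t.
Proof. by rewrite /flat_exp; case: ifP => // _; rewrite hornerC mul1r expR_ge0. Qed.

Lemma flat_exp1_le1 t : flat_exp 1 t <= 1.
Proof.
rewrite /flat_exp; case: ifP => // t0.
by rewrite hornerC mul1r -expR0 ler_expR oppr_le0 invr_ge0 ltW.
Qed.

End flat_exponential.

(** * Smooth functions of compact support built from flat exponentials *)

Section smooth_algebra.
Context {R : realType} {n : nat}.
Local Notation Rn := 'rV[R]_n.+1.
Implicit Types f g : Rn -> R.

Lemma is_derive_line f df x v :
  is_derive (0 : R) (1 : R) (fun h : R => f (h *: v + x)) df -> is_derive x v f df.
Proof.
move=> [d1 d2]; apply: DeriveDef; first exact/derivable1P.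
rewrite -d2 /derive; set g1 := fun h => h^-1 *: _; set g2 := fun h => h^-1 *: _.
suff -> : g1 = g2 by [].
by apply/funext => h; rewrite /g1 /g2 /= addr0 scale0r add0r [_%:A]mulr1.
Qed.

(* All members are smooth because the class is closed under partial derivatives. *)
Inductive smooth_alg : (Rn -> R) -> Prop :=
| smooth_alg_cst c : smooth_alg (cst c)
| smooth_alg_flat Q i m c : smooth_alg (fun x => flat_exp Q (m * x 0 i + c))
| smooth_algD f g : smooth_alg f -> smooth_alg g -> smooth_alg (f + g)
| smooth_algM f g : smooth_alg f -> smooth_alg g -> smooth_alg (f * g).

Lemma smooth_alg_continuous f : smooth_alg f -> continuous f.
Proof.
elim=> {f} [c|Q i m c x|f g _ cf _ cg x|f g _ cf _ cg x].
- exact: cst_continuous.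
- apply: (@continuous_comp _ _ _ (fun x : Rn => m * x 0 i + c) (flat_exp Q)).
    apply: (@continuousD _ _ _ (fun x : Rn => m * x 0 i) (cst c)); last exact: cst_continuous.
    by apply: (@continuousM _ _ (cst m) (fun x : Rn => x 0 i));
      [exact: cst_continuous|exact: coord_continuous].
  exact: continuous_flat_exp.
- exact: continuousD (cf x) (cg x).
- exact: continuousM (cf x) (cg x).
Qed.

Lemma smooth_alg_derive f j : smooth_alg f ->
  exists2 g, smooth_alg g & forall x, is_derive x (delta_mx ord0 j) f (g x).
Proof.
elim=> {f} [c|Q i m c|f g sf [f' sf' df] sg [g' sg' dg]|f g sf [f' sf' df] sg [g' sg' dg]].
- by exists (cst 0) => [|x]; [exact: smooth_alg_cst|exact: is_derive_cst].
(* [d] is 1 for i = j and 0 otherwise, so one formula covers both cases. *)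
- pose d : R := (delta_mx ord0 j : Rn) 0 i.
  exists (cst (m * d) * (fun x => flat_exp (flat_exp_deriv Q) (m * x 0 i + c))).
    by apply: smooth_algM; [exact: smooth_alg_cst|exact: smooth_alg_flat].
  move=> x; apply: is_derive_line.
  have -> : (fun h : R => flat_exp Q (m * (h *: delta_mx ord0 j + x) 0 i + c)) =
      flat_exp Q \o (fun h : R => (m * d) *: h + (m * x 0 i + c)).
    by apply/funext => h /=; rewrite !mxE /d /GRing.scale/= !mxE; congr flat_exp; ring.
  have dl : is_derive (0 : R) (1 : R) (fun h : R => (m * d) *: h + (m * x 0 i + c)) (m * d).
    by apply: is_derive_eq; rewrite addr0 [LHS]mulr1.
  rewrite [X in is_derive _ _ _ X](_ : _ =
    flat_exp (flat_exp_deriv Q) (m * x 0 i + c) * (m * d)); last first.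
    by rewrite mulrC.
  apply: is_derive1_comp.
  by rewrite scaler0 add0r; exact: is_derive_flat_exp.
- by exists (f' + g'); [exact: smooth_algD|move=> x; exact: is_deriveD].
- exists (f * g' + g * f').
    by apply: smooth_algD; exact: smooth_algM.
  by move=> x; exact: is_deriveM.
Qed.

Lemma smooth_alg_smooth f : smooth_alg f -> smooth f.
Proof.
move=> sf s.
have {sf} sg : smooth_alg (foldr partial f s).
  elim: s => //= i s /(smooth_alg_derive i)[g sg dg].
  by rewrite (_ : partial _ _ = g)//; apply/funext => x; have [] := dg x.
split; first exact: smooth_alg_continuous.
by move=> i x; have [g _ dg] := smooth_alg_derive i sg; have [] := dg x.
Qed.

Lemma smooth_alg_prod (I : Type) (r : seq I) (F : I -> Rn -> R) :
  (forall i, smooth_alg (F i)) -> smooth_alg (fun x => \prod_(i <- r) F i x).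
Proof.
move=> sF; elim: r => [|i r ih].
  by under eq_fun do rewrite big_nil; exact: smooth_alg_cst.
under eq_fun do rewrite big_cons; exact: (smooth_algM (sF i) ih).
Qed.

Lemma C0inftyP (U K : set Rn) f : smooth_alg f -> compact K -> K `<=` U ->
  (forall x, f x != 0 -> K x) -> C0infty U f.
Proof.
move=> sf cK KU fK; split; first exact: smooth_alg_smooth.
have clK : closure [set x | f x != 0] `<=` K.
  rewrite closureE; apply: bigcap_inf; split=> //.
  by apply: compact_closed => //; exact: norm_hausdorff.
split; last exact: subset_trans KU.
by apply: subclosed_compact cK clK; exact: closed_closure.
Qed.

(* exp(-1/(k t)) tends to the indicator of t > 0 as k tends to infinity, so no
   smooth step function is needed. *)
Definition box_bump (k : R) (a b : Rn) : Rn -> R :=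
  fun x => \prod_i (flat_exp 1 (k * x 0 i + - (k * a 0 i)) *
                    flat_exp 1 (- k * x 0 i + k * b 0 i)).

Lemma smooth_alg_box_bump k a b : smooth_alg (box_bump k a b).
Proof.
apply: smooth_alg_prod => i.
exact: (smooth_algM (smooth_alg_flat _ _ _ _) (smooth_alg_flat _ _ _ _)).
Qed.

Lemma box_bump_ge0_le1 k a b x : 0 <= box_bump k a b x <= 1.
Proof.
rewrite /box_bump; apply/andP; split.
  by apply: prodr_ge0 => i _; rewrite mulr_ge0// flat_exp1_ge0.
apply: Num.Theory.prodr_ile1 => i _.
by rewrite mulr_ge0 ?mulr_ile1 ?flat_exp1_ge0 ?flat_exp1_le1.
Qed.

Lemma box_bump_support k a b x : 0 < k -> box_bump k a b x != 0 ->
  forall i, a 0 i < x 0 i < b 0 i.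
Proof.
move=> k0 /prodf_neq0 h i; have := h i isT.
rewrite mulf_eq0 negb_or => /andP[/flat_exp_neq0 + /flat_exp_neq0].
by move=> ? ?; apply/andP; split; rewrite -(ltr_pM2l k0); lra.
Qed.

End smooth_algebra.

(** * Convergence of the bumps to the indicator of a half-open box *)

Section box_bump_limit.
Context {R : realType} {n : nat}.
Local Notation Rn := 'rV[R]_n.+1.

Lemma flat_exp1_cvg1 (s : nat -> R) : s @ \oo --> +oo ->
  flat_exp 1 (s k) @[k --> \oo] --> (1 : R).
Proof.
move=> /cvgryPgt soo; apply/cvgrPdist_lt => e e0.
have e1 : 0 < e^-1 by rewrite invr_gt0.
near=> k.
have sk : e^-1 < s k by near: k; exact: soo.
have sk0 : 0 < s k by exact: lt_trans sk.
rewrite ger0_norm ?subr_ge0 ?flat_exp1_le1// /flat_exp sk0 hornerC mul1r.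
have := expR_ge1Dx (- (s k)^-1).
have : (s k)^-1 < e by rewrite invf_plt.
lra.
Unshelve. all: by end_near. Qed.

Variables (m : nat) (a b : Rn) (a_ b_ : nat -> Rn).
Local Notation N k := ((k + m).+1%:R : R).
(** Both corners are approached from above, so that the limit excludes the lower faces and includes
    the upper ones. *)
Hypothesis aa_ : forall k i, a 0 i < a_ k 0 i < a 0 i + (N k)^-1.
Hypothesis bb_ : forall k i, b 0 i + (N k)^-1 < b_ k 0 i < b 0 i + 2 / N k.

Let N_ge (A : R) : \forall k \near \oo, A <= N k.
Proof.
near=> k; have /le_trans -> // : A <= k%:R by near: k; exact: nbhs_infty_ger.
by rewrite ler_nat -addnS leq_addr.
Unshelve. all: by end_near. Qed.

Let N_gt0 k : 0 < N k. Proof. by rewrite ltr0n. Qed.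

(** The scale N^2 outweighs corner shifts of order 1/N. On the box the arguments of the flat
    exponentials are eventually at least N, also when x_i = b_i; off the box some factor is
    eventually 0. *)
Lemma box_bump_cvg x :
  box_bump (N k ^+ 2) (a_ k) (b_ k) x @[k --> \oo] --> (\1_(box (a, b)) x : R).
Proof.
rewrite indicE; have [/set_mem abx|] := boolP (x \in box (a, b)).
  rewrite (_ : true%:R = \prod_(i < n.+1) (1 * 1)) ?big1_eq//; last by rewrite big1// mulr1.
  apply: cvg_big => [|i _]; first by move=> y z; exact: mul_continuous.
  have /andP[ax xb] := abx i; apply: cvgM; apply: flat_exp1_cvg1.
    apply/cvgryPge => A; near=> k.
    have NA : A <= N k by near: k; exact: N_ge.
    (* N times the distance to the lower face is at least 2, of which the shift of the corner takes
       at most 1. *)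
    have Nx : 2 / (x 0 i - a 0 i) <= N k by near: k; exact: N_ge.
    apply: (le_trans NA).
    move: Nx; rewrite ler_pdivrMr ?subr_gt0// => Nx.
    have /andP[_ ak] := aa_ k i.
    have Na : N k * (a_ k 0 i - a 0 i) <= 1.
      by rewrite -ler_pdivlMl// mulr1 lerBlDl ltW.
    rewrite -mulrBr expr2 -mulrA ler_peMr//; lra.
  apply/cvgryPge => A; near=> k.
  have NA : A <= N k by near: k; exact: N_ge.
  apply: (le_trans NA); have /andP[bk _] := bb_ k i.
  rewrite mulNr addrC -mulrBr expr2 -mulrA ler_peMr//.
  by rewrite -ler_pdivrMl// mulr1 lerBrDl (le_trans _ (ltW bk))// lerD2r.
move=> abx; apply: cvg_near_cst.
have [i] : exists i, ~~ (a 0 i < x 0 i <= b 0 i).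
  apply: contrapT => /forallNP h; move/negP: abx; apply; apply/mem_set => i.
  by apply: contrapT => /negP; exact: h.
rewrite negb_and -leNgt -ltNge => xab; near=> k.
apply/eqP; apply: contraT => /box_bump_support => /(_ (exprn_gt0 2 (N_gt0 k)) i) /andP[ax xb].
have /andP[aa _] := aa_ k i; have /andP[_ bb] := bb_ k i.
case/orP: xab => [xa|bx]; first by have := lt_trans (le_lt_trans xa aa) ax; rewrite ltxx.
have Nx : 2 / (x 0 i - b 0 i) <= N k by near: k; exact: N_ge.
move: Nx; rewrite ler_pdivrMr ?subr_gt0// -ler_pdivrMl ?N_gt0// mulrC => Nx.
by have := lt_trans xb bb; rewrite -ltrBlDl => /lt_le_trans/(_ Nx); rewrite ltxx.
Unshelve. all: by end_near. Qed.

End box_bump_limit.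

(** * Test functions in the variable exponent Lebesgue space *)

Section lebesgue_density.
Context {R : realType} {n : nat}.
Local Notation Rn := 'rV[R]_n.+1.
Local Notation T := (@lebesgue_type R n).
Local Notation mu := (@lebesgue_rV R n).
Variables (p : Rn -> R) (Omega : set Rn).
Hypotheses (oO : open Omega) (cp : {within Omega, continuous p}).
Hypothesis p1 : forall x, Omega x -> 1 <= p x.
Local Notation rho := (fun_modular p Omega).
Local Notation measO u := (measurable_fun (Omega : set T) u).
Implicit Types u v : Rn -> R.
Local Notation Rat := 'rV[rat]_n.+1.

Let mO : measurable (Omega : set T). Proof. exact: open_lebesgue_measurable. Qed.
Let mp : measO p. Proof. exact: continuous_lebesgue_measurable. Qed.

Lemma compact_exponent_bound (K : set Rn) : compact K -> K `<=` Omega ->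
  exists P : R, forall x, K x -> p x <= P.
Proof.
move=> cK KO; have [->|/set0P K0] := eqVneq K set0; first by exists 0.
have cpK : {within K, continuous p} by exact: continuous_subspaceW cp.
by have [c _ cmax] := compact_EVT_max K0 cK cpK; exists (p c) => x /mem_set/cmax.
Qed.

Lemma compact_lebesgue_measurable (K : set Rn) : compact K -> measurable (K : set T).
Proof.
move=> cK; rewrite -(setCK K); apply: (@measurableC _ T).
apply: open_lebesgue_measurable; apply: closed_openC.
by apply: compact_closed => //; exact: norm_hausdorff.
Qed.

Lemma compact_lebesgue_lty (K : set Rn) : compact K -> (mu K < +oo)%E.
Proof.
move=> /compact_bounded[M [_ KM]].
apply: le_lt_trans (lebesgue_outer_closed_box (const_mx (- (M + 1))) (const_mx (M + 1))).
apply: le_outer_measure => x /(KM (M + 1)) xM i.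
rewrite !mxE -ler_norml; apply: le_trans (xM _); last by rewrite ltrDl.
rewrite {2}/Num.norm /= mx_normrE.
exact: (le_bigmax _ (fun ij : 'I_1 * 'I_n.+1 => `|x ij.1 ij.2|) (0, i)).
Qed.

Lemma compact_support_modular (K : set Rn) (M : R) u : compact K -> K `<=` Omega ->
  measO u -> (forall x, Omega x -> `|u x| <= M * \1_K x) -> (rho u < +oo)%E.
Proof.
move=> cK KO mu_ uM; have [P KP] := compact_exponent_bound cK KO.
have mK := compact_lebesgue_measurable cK.
have m1 : measO (fun x => M * \1_K x).
  by apply: measurable_funM; [exact: measurable_cst|exact: measurable_indic].
apply: (@le_lt_trans _ _ (rho (fun x => M * \1_K x))).
  apply: (le_int_modular mu mO mp p1 mu_ m1) => x Ox.
  by rewrite (le_trans (uM x Ox))// ler_norm.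
apply: le_lt_trans (int_modular_indic_le mu mO mp p1 M mK KO KP) _.
by rewrite lte_mul_pinfty ?lee_fin ?powR_ge0//; exact: compact_lebesgue_lty.
Qed.

Lemma Lp_set_finite_modular u : measO u -> (rho u < +oo)%E ->
  Lp_set p Omega (to_class Omega u).
Proof.
move=> mu_ ru; exists u; split; [by []|exact: mu_|exists 1; first exact: ltr01].
by rewrite (_ : (fun _ => _) = u)//; apply/funext => x; rewrite mul1r.
Qed.

Lemma sub_C0infty_Lp_set : to_class Omega @` C0infty Omega `<=` Lp_set p Omega.
Proof.
move=> _ [f [sf [cK KO]] <-].
have cf : continuous f by have [] := sf [::].
have mf : measO f.
  by apply: continuous_lebesgue_measurable; [exact: oO|exact: continuous_subspaceT].
apply: (Lp_set_finite_modular mf).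
set K := closure _ in cK KO.
have [M fM] : exists M : R, forall x, K x -> `|f x| <= M.
  have [->|/set0P K0] := eqVneq K set0; first by exists 0.
  have cfK : {within K, continuous (fun x => `|f x|)}.
    by apply: continuous_subspaceT => x; apply: continuous_comp (cf x) _; exact: norm_continuous.
  by have [c _ cmax] := compact_EVT_max K0 cK cfK; exists `|f c| => x /mem_set/cmax.
apply: (compact_support_modular cK KO mf (M := M)) => x Ox.
rewrite indicE; have [/set_mem Kx|nK] := boolP (x \in K); first by rewrite mulr1 fM.
rewrite mulr0; have [->|fx0] := eqVneq (f x) 0; first by rewrite normr0.
by move: nK; rewrite mem_set//; exact: subset_closure.
Qed.

(** Rational parameters keep the atoms countable; the squared scale is that of [box_bump_cvg]. *)
Definition test_atom (t : rat * nat * (Rat * Rat)) : Rn -> R :=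
  cst (ratr t.1.1) *
  box_bump (t.1.2.+1%:R ^+ 2) (map_mx ratr t.2.1) (map_mx ratr t.2.2).

Definition test_atom_in (t : rat * nat * (Rat * Rat)) : Prop :=
  closed_box (map_mx ratr t.2.1) (map_mx ratr t.2.2 : Rn) `<=` Omega.

Local Notation S := (finite_sums test_atom_in (fun t => to_class Omega (test_atom t))).
Local Notation cl := (modular_closure (Lp_modular p Omega) (Lp_set p Omega) S).

Lemma sub_test_sums_C0infty : S `<=` to_class Omega @` C0infty Omega.
Proof.
move=> _ [s sP ->].
(* A compact set containing all nonzero points is carried through the induction: it grows by union
   at each summand. *)
suff [f [K [sf cK KO fK <-]]] : exists f K, [/\ smooth_alg f, compact K, K `<=` Omega,
    (forall x, f x != 0 -> K x) &
    to_class Omega f = \sum_(t <- s) to_class Omega (test_atom t)].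
  by exists f => //; exact: C0inftyP sf cK KO fK.
elim: s sP => [|t s ih] sP.
  exists 0, set0; split=> //; [exact: smooth_alg_cst|exact: compact0| |].
    by move=> x; rewrite eqxx.
  by rewrite big_nil; exact: raddf0.
have [|f [K [sf cK KO fK fE]]] := ih.
  by move=> u us; apply: sP; rewrite in_cons us orbT.
exists (test_atom t + f), (closed_box (map_mx ratr t.2.1) (map_mx ratr t.2.2) `|` K).
split.
- apply: smooth_algD sf; apply: smooth_algM; first exact: smooth_alg_cst.
  exact: smooth_alg_box_bump.
- by apply: compactU => //; exact: compact_closed_box.
- by rewrite subUset; split=> //; apply: sP; rewrite mem_head.
- move=> x; have [tx|/box_bump_support bx _] := eqVneq (box_bump (t.1.2.+1%:R ^+ 2)
      (map_mx ratr t.2.1) (map_mx ratr t.2.2) x : R) 0.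
    rewrite -[X in X != 0]/(ratr t.1.1 * box_bump _ _ _ x + f x) tx mulr0 add0r => fx0.
    by right; exact: fK.
  left => i; have /andP[] := bx (exprn_gt0 2 (ltr0Sn _ _)) i.
  by move=> /ltW -> /ltW ->.
- by rewrite big_cons -fE; exact: to_classD.
Qed.

Let clD c d : cl c -> cl d -> cl (c + d).
Proof.
apply: modular_closure_add; last exact: finite_sumsD.
  exact: (Lp_setD mO mp p1).
exact: subset_trans sub_test_sums_C0infty sub_C0infty_Lp_set.
Qed.

Lemma cl_lim u : measO u -> (rho u < +oo)%E ->
  (forall e : R, 0 < e -> exists v, [/\ measO v, cl (to_class Omega v) &
     (rho (v - u)%R < e%:E)%E]) -> cl (to_class Omega u).
Proof.
move=> mu_ ru uv; apply: modular_closure_lim; first exact: Lp_set_finite_modular.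
move=> e /uv[v [mv cv vu]]; exists (to_class Omega v); first exact: cv.
rewrite -to_classB (Lp_modular_to_class mO mp p1); first exact: vu.
exact: measurable_funB.
Qed.

Lemma cl_test_atom t : test_atom_in t -> cl (to_class Omega (test_atom t)).
Proof.
move=> tO; apply: subset_modular_closure.
  exact: subset_trans sub_test_sums_C0infty sub_C0infty_Lp_set.
exact: (finite_sums_atom _ tO).
Qed.

(** Atoms with rational parameters slightly above [c], [a] and [b] converge pointwise to the target.
    The margin [d] keeps their supports in one compact subset of [Omega], which provides the
    domination. *)
Lemma cl_good_box ab (c : R) : good_box Omega ab ->
  cl (to_class Omega (fun x => c * \1_(box ab) x)).
Proof.
case: ab => a b [d d0 /= abO].
(* Starting at [m] makes 2/N at most [d] for every [k], so that all the bumps stay within the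
   margin. *)
pose m := (Num.truncn (2 / d)).+1.
pose N k : R := (k + m).+1%:R.
have N0 k : 0 < N k by rewrite ltr0n.
have Nd k : 2 / N k <= d.
  rewrite ler_pdivrMr// mulrC -ler_pdivrMr// (le_trans (ltW (truncnS_gt _)))//.
  by rewrite ler_nat -/m ltnW// ltnS leq_addl.
have N1 k : (N k)^-1 <= 1 by rewrite invf_le1// ler1n.
have [q qP] : {q : nat -> rat & forall k, c < ratr (q k) < c + (N k)^-1}.
  apply: (@choice _ _ (fun k q => c < ratr q < c + (N k)^-1)) => k.
  have [|q] := @rat_in_itvoo R c (c + (N k)^-1); first by rewrite ltrDl invr_gt0.
  by rewrite in_itv /=; exists q.
have row_rat (l h : nat -> 'I_n.+1 -> R) : (forall k i, l k i < h k i) ->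
    {r : nat -> Rat & forall k i, l k i < (map_mx ratr (r k) : Rn) 0 i < h k i}.
  move=> lh; apply: (@choice _ _ (fun k (r : Rat) =>
    forall i, l k i < (map_mx ratr r : Rn) 0 i < h k i)) => k.
  have [r rP] : {r : 'I_n.+1 -> rat & forall i, l k i < ratr (r i) < h k i}.
    apply: (@choice _ _ (fun i r => l k i < ratr r < h k i)) => i.
    by have [r] := rat_in_itvoo (lh k i); rewrite in_itv /=; exists r.
  by exists (\row_i r i) => i; rewrite !mxE.
have [a_ aP] := row_rat (fun _ i => a 0 i) (fun k i => a 0 i + (N k)^-1)
  (fun k i => ltac:(by rewrite ltrDl invr_gt0)).
have [b_ bP] := row_rat (fun k i => b 0 i + (N k)^-1) (fun k i => b 0 i + 2 / N k)
  (fun k i => ltac:(by rewrite ltrD2l ltr_pdivlMr// mulVf ?gt_eqF// ltr1n)).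
pose t k : rat * nat * (Rat * Rat) := ((q k, (k + m)%N), (a_ k, b_ k)).
pose K := closed_box a (b + const_mx d).
have cK : compact K by exact: compact_closed_box.
have tK k : closed_box (map_mx ratr (a_ k)) (map_mx ratr (b_ k)) `<=` K.
  move=> x abx i; have /andP[ax xb] := abx i.
  have /andP[aa _] := aP k i; have /andP[_ bb] := bP k i.
  rewrite (le_trans (ltW aa) ax)/= (le_trans xb)// (le_trans (ltW bb))//.
  by rewrite !mxE lerD2l.
have mt k : measO (test_atom (t k)).
  apply: continuous_lebesgue_measurable; first exact: oO.
  apply: continuous_subspaceT; apply: smooth_alg_continuous.
  by apply: smooth_algM; [exact: smooth_alg_cst|exact: smooth_alg_box_bump].
have mZ (e : R) E : measurable (E : set T) -> measO (fun x => e * \1_E x).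
  by move=> mE; apply: measurable_funM; [exact: measurable_cst|exact: measurable_indic].
have mu_ := mZ c _ (box_measurable (a, b)).
(* |c| + 1 bounds the rational coefficients, as 1/N is at most 1; the second |c| bounds the
   target. *)
have mw := mZ (`|c| + 1 + `|c|) _ (compact_lebesgue_measurable cK).
have boxK : box (a, b) `<=` K.
  move=> x abx i; have /andP[ax xb] := abx i.
  by rewrite ltW//= !mxE (le_trans xb)// lerDl ltW.
have ind0 (E : set Rn) x : 0 <= \1_E x :> R by rewrite indicE.
have ind1 (E : set Rn) x : \1_E x <= 1 :> R by rewrite indicE; case: (_ \in _).
apply: (clo_dominated mO mp p1 cl_lim (v := fun k => test_atom (t k))
  (w := fun x => (`|c| + 1 + `|c|) * \1_K x) mt _ mu_ _ mw).
- by move=> k; apply: cl_test_atom => x /tK; exact: abO.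
- apply: (compact_support_modular (M := `|c|) cK abO mu_) => x Ox.
  rewrite normrM ler_wpM2l// !indicE.
  have [/set_mem/boxK xK|_] := boolP (x \in box (a, b)); last by rewrite normr0.
  by rewrite mem_set// normr1.
- apply: (compact_support_modular (M := `|c| + 1 + `|c|) cK abO mw) => x Ox.
  by rewrite ger0_norm// mulr_ge0// !addr_ge0.
- move=> k x Ox; rewrite (le_trans (ler_normB _ _))// mulrDl lerD//.
    rewrite /test_atom -[X in `|X|]/(ratr (q k) * box_bump (N k ^+ 2) _ _ x) normrM.
    have [xK|xK] := boolP (x \in K).
      rewrite indicE xK mulr1.
      have /andP[h0 h1] := box_bump_ge0_le1 (N k ^+ 2) (map_mx ratr (a_ k)) (map_mx ratr (b_ k)) x.
      rewrite -[leRHS]mulr1 ler_pM//; last by rewrite ger0_norm.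
      have /andP[q0 q1] := qP k; move: q0 q1 (N1 k).
      move: (ratr (q k)) (N k)^-1 (ler_norm c) (lerNnormlW (lexx `|c|)) => y z.
      by rewrite ler_norml; lra.
    rewrite indicE (negbTE xK) mulr0.
    suff -> : box_bump (N k ^+ 2) (map_mx ratr (a_ k)) (map_mx ratr (b_ k)) x = 0.
      by rewrite normr0 mulr0.
    apply/eqP; apply: contraNT xK => /box_bump_support bx; apply/mem_set/(tK k) => i.
    by have /andP[ax xb] := bx (exprn_gt0 2 (N0 k)) i; apply/andP; split; exact: ltW.
  rewrite normrM ler_wpM2l// !indicE.
  have [/set_mem/boxK xK|_] := boolP (x \in box (a, b)); last by rewrite normr0.
  by rewrite mem_set// normr1.
- move=> x Ox; apply: cvgM; last exact: box_bump_cvg.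
  apply/cvgrPdist_lt => e e0; near=> k.
  have Ne : e^-1 <= N k.
    have /le_trans -> // : e^-1 <= k%:R by near: k; exact: nbhs_infty_ger.
    by rewrite ler_nat -addnS leq_addr.
  have /andP[q0 q1] := qP k.
  rewrite distrC gtr0_norm ?subr_gt0// ltrBlDl (lt_le_trans q1)// lerD2l.
  by rewrite invf_ple ?posrE.
Unshelve. all: by end_near. Qed.

Lemma box_setI (ab cd : Rn * Rn) : box ab `&` box cd =
  box (\row_i Num.max (ab.1 0 i) (cd.1 0 i), \row_i Num.min (ab.2 0 i) (cd.2 0 i)).
Proof.
apply/seteqP; split=> [x [abx cdx] i|x h].
  have /andP[ax xb] := abx i; have /andP[cx xd] := cdx i.
  by rewrite !mxE gt_max le_min ax cx xb xd.
split=> i; have := h i; rewrite !mxE gt_max le_min => /andP[/andP[ax cx] /andP[xb xd]].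
  by rewrite ax xb.
by rewrite cx xd.
Qed.

Definition good_boxes : set (set Rn) :=
  [set E | exists2 ab, E = box ab & box ab = set0 \/ good_box Omega ab].

(** Cutting by any box can only raise the lower corner and lower the upper one, so the margin of the
    first box still serves. *)
Lemma good_boxesI (E : set Rn) cd : good_boxes E -> good_boxes (E `&` box cd).
Proof.
move=> [ab -> gab]; rewrite box_setI; eexists; first by [].
case: gab => [ab0|[e e0 abO]]; first by left; rewrite -box_setI ab0 set0I.
right; exists e => //= x h; apply: abO => i; have := h i.
rewrite !mxE ge_max => /andP[/andP[-> _] /le_trans]; apply.
by rewrite lerD2r ge_min lexx.
Qed.

Lemma good_boxes_cover (B E : set Rn) (e : R) : good_boxes B ->
  measurable (E : set T) -> E `<=` B -> 0 < e ->
  exists F : nat -> set Rn, [/\ forall k, good_boxes (F k), E `<=` \bigcup_k F k,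
    \bigcup_k F k `<=` B & (mu (\bigcup_k F k) <= mu E + e%:E)%E].
Proof.
move=> gB mE EB e0.
have Efin : lebesgue_outer E \is a fin_num.
  rewrite ge0_fin_numE; last exact: outer_measure_ge0.
  have [ab Bab _] := gB; apply: (@le_lt_trans _ _ (box_vol ab)); last exact: ltey.
  apply: le_trans (lebesgue_outer_box ab).
  by apply: le_outer_measure; rewrite -Bab.
have [_ [F EF <-] Fe] := lb_ereal_inf_adherent e0 Efin.
(* A nearly optimal cover, cut to [B] so that its pieces are good boxes; the uncut boxes still bound
   the measure of the union. *)
exists (fun k => B `&` box (F k)); split.
- by move=> k; exact: good_boxesI.
- by move=> x Ex; have [k _ Fx] := EF x Ex; exists k => //; split=> //; exact: EB.
- by move=> x [k _ []].
- apply: ltW; apply: le_lt_trans Fe; apply: ereal_inf_lbound; exists F => //.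
  by move=> x [k _ [_ Fx]]; exists k.
Qed.

Lemma sub_Lp_set_cl : Lp_set p Omega `<=` cl.
Proof.
move=> _ [u [<- mu_ [l l0 lu]]].
apply: (clo_modular mO mp p1 (clo := fun u => cl (to_class Omega u)) (boxes := good_boxes)
  _ cl_lim _ _ _ _ _ _ good_boxes_cover _ l0 mu_ lu).
- by move=> v w _ _ cv cw; rewrite to_classD; exact: clD.
- by move=> _ [ab -> _]; exact: box_measurable.
- by move=> E F gE [cd -> _]; exact: good_boxesI.
- by move=> _ [ab -> [->|/good_box_sub]].
- move=> _ [[a b] -> [->|[d d0 abO]]]; first by exists 0.
  have [P KP] := compact_exponent_bound (@compact_closed_box _ _ _ _) abO.
  exists P => x abx; apply: KP => i; have /andP[ax xb] := abx i.
  by rewrite ltW//= !mxE (le_trans xb)// lerDl ltW.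
- move=> _ [ab -> _]; apply: (le_lt_trans (lebesgue_outer_box ab)).
  exact: ltey.
- move=> _ c [ab -> [->|/cl_good_box//]].
  (* An empty box gives the zero class, which is the empty sum of atoms. *)
  rewrite (_ : to_class Omega _ = 0).
    apply: subset_modular_closure; last exact: finite_sums0.
    exact: subset_trans sub_test_sums_C0infty sub_C0infty_Lp_set.
  rewrite -[RHS](raddf0 (to_class Omega)); congr to_class.
  by apply/funext => x; rewrite indicE in_set0 mulr0.
- have [B [gB OB]] := good_box_cover oO; exists (fun k => box (B k)); split=> // k.
  by exists (B k).
Qed.

Lemma separable_Lp_space :
  dense [set c : Lp_space p Omega | (to_class Omega @` C0infty Omega) (val c)] /\
  separable_space (Lp_space p Omega).
Proof.
split; last first.
  exact: separable_modular_closure (countable_finite_sums _ _) sub_Lp_set_cl.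
have dS := dense_modular_closure sub_Lp_set_cl.
by move=> A A0 oA; have [c [Ac /sub_test_sums_C0infty cc]] := dS A A0 oA; exists c.
Qed.

End lebesgue_density.

(** * Density and separability in both spaces *)

Theorem theorem6p5 (R : realType) :
  (forall p : nat -> R,
     (forall j, 1 <= p j) -> ~ has_ubound (range p) ->
     [/\ c00 `<=` ell_set p,
         dense [set a : ell_space p | c00 (val a)] &
         separable_space (ell_space p)]) /\
  (forall (n : nat) (Omega : set 'rV[R]_n.+1) (p : 'rV[R]_n.+1 -> R),
     open Omega -> connected Omega -> Omega !=set0 ->
     {within Omega, continuous p} -> (forall x, Omega x -> 1 <= p x) ->
     [/\ to_class Omega @` C0infty Omega `<=` Lp_set p Omega,
         dense [set c : Lp_space p Omega |
                  (to_class Omega @` C0infty Omega) (val c)] &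
         separable_space (Lp_space p Omega)]).
Proof.
split=> [p p1 _|n Omega p oO _ _ cp p1].
  have [dS sS] := separable_ell_space p1.
  by split; [exact: sub_c00_ell_set|exact: dS|exact: sS].
have [dS sS] := separable_Lp_space oO cp p1.
by split; [exact: sub_C0infty_Lp_set|exact: dS|exact: sS].
Qed.
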